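(* Let $\mathcal{S}=(\mathcal{C},T,R,\mathfrak{l},\mathfrak{t},\mathfrak{r})$ be a braided pair of monads and let $\varphi:R\to T$ be a braid preserving monad morphism. Let $X$ be an $(R,R)$-bimodule and let $w:\overline{T}_iX\to\overline{T}_oX$ be an $(R,R)$-bimodule morphism such that, with $\widetilde{w}:=w\circ\pi_iX$, $$\widetilde{w}\circ\tau X=\overline{\tau}_oX\qquad\text{and}\qquad\widetilde{w}\circ tX=\overline{t}_oX\circ\overline{T}_o\widetilde{w}\circ\mathfrak{t}'X\circ T\widetilde{w}\circ\mathfrak{t}X.$$ Then $w$ determines a para-cocyclic structure on the cosimplex $\Pi\overline{T}_o^{\,*+1}X$, with para-cocyclic morphism in degree $n$ $$w_n:=\Pi\overline{T}_o^{\,n}w\circ\Pi\overline{T}_o^{\,n-1}\overline{\mathfrak{t}}X\circ\Pi\overline{T}_o^{\,n-2}\overline{\mathfrak{t}}\,\overline{T}_oX\circ\cdots\circ\Pi\overline{T}_o\overline{\mathfrak{t}}\,\overline{T}_o^{\,n-2}X\circ\Pi\overline{\mathfrak{t}}\,\overline{T}_o^{\,n-1}X\circ\mathfrak{i}\,\overline{T}_o^{\,n}X:\ \Pi\overline{T}_o^{\,n+1}X\to\Pi\overline{T}_o^{\,n+1}X.$$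
   Context: Notation. Composition of functors is juxtaposition, $\circ$ is composition of morphisms (vertical composition of natural transformations); for $\mu:F\to F'$, $G\mu X$ denotes $G(\mu_X)$ and $\mu GX$ denotes $\mu_{GX}$. Forgetful functors are omitted when harmless. Monads. A monad on $\mathcal{C}$ is a triple $(R,r,\rho)$ with multiplication $r:RR\to R$ and unit $\rho:\mathrm{Id}\to R$. A morphism of monads $\varphi:(R,r,\rho)\to(T,t,\tau)$ is a natural transformation with $\varphi\circ r=t\circ\varphi T\circ R\varphi$ and $\varphi\circ\rho=\tau$. An $R$-module is $(X,x)$ with $x:RX\to X$, $x\circ Rx=x\circ rX$, $x\circ\rho X=\mathrm{Id}_X$; morphisms commute with the actions. Distributive laws. A distributive law $\mathfrak{l}:RT\to TR$ between monads $(R,r,\rho)$ and $(T,t,\tau)$ is a natural transformation with $\mathfrak{l}\circ rT=Tr\circ\mathfrak{l}R\circ R\mathfrak{l}$, $\mathfrak{l}\circ Rt=tR\circ T\mathfrak{l}\circ\mathfrak{l}T$, $\mathfrak{l}\circ\rho T=T\rho$, $\mathfrak{l}\circ R\tau=\tau R$. A BD-law on $(T,t,\tau)$ is a distributive law $\mathfrak{t}:TT\to TT$ with $\mathfrak{t}T\circ T\mathfrak{t}\circ\mathfrak{t}T=T\mathfrak{t}\circ\mathfrak{t}T\circ T\mathfrak{t}$. Braided pair of monads. This is a sextuple $(\mathcal{C},T,R,\mathfrak{l},\mathfrak{t},\mathfrak{r})$ where: $\mathcal{C}$ is a category in which any pair of parallel morphisms has a coequalizer; $(R,r,\rho)$ and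 $(T,t,\tau)$ are monads on $\mathcal{C}$, both preserving coequalizers; $\mathfrak{l}:RT\to TR$ is an invertible distributive law; $\mathfrak{t}:TT\to TT$ and $\mathfrak{r}:RR\to RR$ are invertible BD-laws; and (A1) $T\mathfrak{r}\circ\mathfrak{l}R\circ R\mathfrak{l}=\mathfrak{l}R\circ R\mathfrak{l}\circ\mathfrak{r}T$, (A2) $\mathfrak{t}R\circ T\mathfrak{l}\circ\mathfrak{l}T=T\mathfrak{l}\circ\mathfrak{l}T\circ R\mathfrak{t}$. A morphism of monads $\varphi:R\to T$ is braid preserving if (A3) $\varphi R\circ\mathfrak{r}=\mathfrak{l}\circ R\varphi$ and $R\varphi\circ\mathfrak{r}=\mathfrak{l}^{-1}\circ\varphi R$, (A4) $\mathfrak{t}\circ\varphi T=T\varphi\circ\mathfrak{l}$ and $\mathfrak{t}\circ T\varphi=\varphi T\circ\mathfrak{l}^{-1}$. Bimodules. $R^{\mathfrak{r}}$ denotes the monad with underlying functor $R$, multiplication $r\circ\mathfrak{r}$ and unit $\rho$. An $(R,R)$-bimodule is a triple $(X,x,x^0)$ with $(X,x)$ an $R$-module, $(X,x^0)$ an $R^{\mathfrak{r}}$-module and $x\circ Rx^0\circ\mathfrak{r}X=x^0\circ Rx$. Bimodule morphisms commute with both actions; the category is ${}_R\mathcal{C}_R$. Functors $T_i,T_o:{}_R\mathcal{C}_R\to{}_R\mathcal{C}_R$. For an $(R,R)$-bimodule $(X,x,x^0)$: $T_iX=(TX,x_i,x_i^0)$ with $x_i=Tx\circ\mathfrak{l}X$,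 $x_i^0=tX\circ T\varphi X\circ\mathfrak{l}X$; $T_oX=(TX,x_o,x_o^0)$ with $x_o=tX\circ\varphi TX$, $x_o^0=Tx^0\circ\mathfrak{l}X$; both send a morphism $f$ to $Tf$. Monads $\overline{T}_o,\overline{T}_i$ on ${}_R\mathcal{C}_R$. As objects of $\mathcal{C}$, $(\overline{T}_oX,\pi_oX)=\mathrm{Coeq}(x_i,x_i^0)$ and $(\overline{T}_iX,\pi_iX)=\mathrm{Coeq}(x_o,x_o^0)$, with the unique bimodule structures such that $\pi_oX:T_oX\to\overline{T}_oX$ and $\pi_iX:T_iX\to\overline{T}_iX$ are bimodule morphisms. The units are $\overline{\tau}_o=\pi_o\circ\tau$ and $\overline{\tau}_i=\pi_i\circ\tau$. The multiplications are the unique morphisms with $\overline{t}_oX\circ\pi_o\overline{T}_oX\circ T\pi_oX=\pi_oX\circ tX$ and $\overline{t}_iX\circ\pi_i\overline{T}_iX\circ T\pi_iX=\pi_iX\circ tX\circ\mathfrak{t}^{-1}X$. Functor $\Pi:{}_R\mathcal{C}_R\to\mathcal{C}$: $(\Pi X,pX)=\mathrm{Coeq}(x,x^0)$ for $(X,x,x^0)$, and $\Pi f$ is the unique morphism with $\Pi f\circ pX=pY\circ f$. Natural transformations: $\mathfrak{t}':T_i\overline{T}_o\to\overline{T}_oT_i$ is the (unique) one with $\mathfrak{t}'\circ T_i\pi_o=\pi_oT_i\circ\mathfrak{t}$; $\overline{\mathfrak{t}}:\overline{T}_i\overline{T}_o\to\overline{T}_o\overline{T}_i$ is the one with $\pi_o\overline{T}_i\circ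 T_o\pi_i\circ\mathfrak{t}=\overline{\mathfrak{t}}\circ\pi_i\overline{T}_o\circ T_i\pi_o$; $\mathfrak{i}:\Pi\overline{T}_o\to\Pi\overline{T}_i$ is the one with $\mathfrak{i}\circ p\overline{T}_o\circ\pi_o=p\overline{T}_i\circ\pi_i$. The cosimplex $Z^*=\Pi\overline{T}_o^{\,*+1}X$ in $\mathcal{C}$ has $Z^n=\Pi\overline{T}_o^{\,n+1}X$, cofaces $d_k=\Pi\overline{T}_o^{\,k}\,\overline{\tau}_o\,\overline{T}_o^{\,n-k}X:Z^{n-1}\to Z^n$ and codegeneracies $s_k=\Pi\overline{T}_o^{\,k}\,\overline{t}_o\,\overline{T}_o^{\,n-k}X:Z^{n+1}\to Z^n$, $k=0,\dots,n$. A para-cocyclic structure on a cosimplex $(Z^*,d,s)$ is a sequence of morphisms $w_n:Z^n\to Z^n$, $n\ge 0$ (not required to be invertible or to satisfy $w_n^{n+1}=\mathrm{Id}$), such that $w_n\circ d_0=d_n$ and $w_n\circ d_k=d_{k-1}\circ w_{n-1}$ for $n\ge1$, $1\le k\le n$, and $w_n\circ s_0=s_n\circ w_{n+1}^2$ and $w_n\circ s_k=s_{k-1}\circ w_{n+1}$ for $1\le k\le n$. *)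

(* Defs.v *)
From Stdlib Require Import ssreflect Classical ClassicalEpsilon Lia.

Set Implicit Arguments.
Unset Strict Implicit.
Unset Printing Implicit Defensive.

Record Category := MkCategory {
  Ob :> Type;
  Hom : Ob -> Ob -> Type;
  idm : forall X, Hom X X;
  comp : forall X Y Z, Hom Y Z -> Hom X Y -> Hom X Z;
  comp_idl : forall X Y (f : Hom X Y), comp (idm Y) f = f;
  comp_idr : forall X Y (f : Hom X Y), comp f (idm X) = f;
  comp_assoc : forall X Y Z W (h : Hom Z W) (g : Hom Y Z) (f : Hom X Y),
    comp h (comp g f) = comp (comp h g) f
}.
Arguments Hom {_} _ _.
Arguments idm {_} X.
Arguments comp {_ X Y Z} g f.
Arguments comp_idl {_ X Y} f.
Arguments comp_idr {_ X Y} f.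
Arguments comp_assoc {_ X Y Z W} h g f.

Notation "g ∘ f" := (comp g f) (at level 60, right associativity).

Record Functor (C D : Category) := MkFunctor {
  fobj :> C -> D;
  fmap : forall X Y, Hom X Y -> Hom (fobj X) (fobj Y);
  fmap_id : forall X, fmap (idm X) = idm (fobj X);
  fmap_comp : forall X Y Z (g : Hom Y Z) (f : Hom X Y),
    fmap (g ∘ f) = fmap g ∘ fmap f
}.
Arguments fmap {C D} F {X Y} f : rename.
Arguments fmap_id {C D} F X : rename.
Arguments fmap_comp {C D} F {X Y Z} g f : rename.

Definition fid (C : Category) : Functor C C :=
  @MkFunctor C C (fun X => X) (fun _ _ f => f)
    (fun _ => eq_refl) (fun _ _ _ _ _ => eq_refl).

Section FunctorComposition.
Context (C D E : Category) (G : Functor D E) (F : Functor C D).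

Lemma fcomp_id X : fmap G (fmap F (idm X)) = idm (G (F X)).
Proof. by rewrite !fmap_id. Qed.

Lemma fcomp_comp X Y Z (g : Hom Y Z) (f : Hom X Y) :
  fmap G (fmap F (g ∘ f)) = fmap G (fmap F g) ∘ fmap G (fmap F f).
Proof. by rewrite !fmap_comp. Qed.

Definition fcomp : Functor C E :=
  @MkFunctor C E (fun X => G (F X)) (fun _ _ f => fmap G (fmap F f))
    fcomp_id fcomp_comp.
End FunctorComposition.

Record NatTrans (C D : Category) (F G : Functor C D) := MkNatTrans {
  component :> forall X, Hom (F X) (G X);
  naturality : forall X Y (f : Hom X Y),
    component Y ∘ fmap F f = fmap G f ∘ component X
}.
Arguments naturality {C D F G} n {X Y} f : rename.

Record NatIso (C D : Category) (F G : Functor C D) := MkNatIso {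
  iso_hom :> NatTrans F G;
  iso_inv : NatTrans G F;
  iso_invK : forall X, iso_inv X ∘ iso_hom X = idm (F X);
  iso_homK : forall X, iso_hom X ∘ iso_inv X = idm (G X)
}.

Section Coequalizers.
Context (C : Category).

Definition is_coequalizer (X Y Q : C) (f g : Hom X Y) (q : Hom Y Q) : Prop :=
  q ∘ f = q ∘ g /\
  forall (Z : C) (h : Hom Y Z), h ∘ f = h ∘ g ->
    exists k : Hom Q Z, k ∘ q = h /\ forall k', k' ∘ q = h -> k' = k.

Record Coequalizer (X Y : C) (f g : Hom X Y) := MkCoequalizer {
  coeq_ob : C;
  coeq_map : Hom Y coeq_ob;
  coeqP : is_coequalizer f g coeq_map
}.

Section Desc.
Context (X Y Q : C) (f g : Hom X Y) (q : Hom Y Q) (cq : is_coequalizer f g q).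

Lemma coeq_eq : q ∘ f = q ∘ g.
Proof. by case: cq. Qed.

Lemma coeq_epi Z (k k' : Hom Q Z) : k ∘ q = k' ∘ q -> k = k'.
Proof.
move=> E; case: cq => e /(_ Z (k' ∘ q)) [|m [_ U]].
  by rewrite -!comp_assoc e.
by rewrite (U k E) (U k' eq_refl).
Qed.

Lemma coeq_ex Z (h : Hom Y Z) (E : h ∘ f = h ∘ g) : exists k, k ∘ q = h.
Proof. by case: cq => _ /(_ Z h E) [k [Ek _]]; exists k. Qed.

Definition coeq_desc Z (h : Hom Y Z) (E : h ∘ f = h ∘ g) : Hom Q Z :=
  proj1_sig (constructive_indefinite_description _ (coeq_ex E)).

Lemma coeq_descE Z (h : Hom Y Z) (E : h ∘ f = h ∘ g) : coeq_desc E ∘ q = h.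
Proof. exact: (proj2_sig (constructive_indefinite_description _ (coeq_ex E))). Qed.
End Desc.

Definition preserves_coequalizers (F : Functor C C) : Prop :=
  forall (X Y Q : C) (f g : Hom X Y) (q : Hom Y Q),
    is_coequalizer f g q -> is_coequalizer (fmap F f) (fmap F g) (fmap F q).
End Coequalizers.
Arguments coeq_ob {C X Y f g} _.
Arguments coeq_map {C X Y f g} _.
Arguments coeqP {C X Y f g} _.

Record Monad (C : Category) := MkMonad {
  mfun :> Functor C C;
  mul : NatTrans (fcomp mfun mfun) mfun;
  unt : NatTrans (fid C) mfun;
  mul_assoc : forall X, mul X ∘ fmap mfun (mul X) = mul X ∘ mul (mfun X);
  mul_unitl : forall X, mul X ∘ unt (mfun X) = idm (mfun X);
  mul_unitr : forall X, mul X ∘ fmap mfun (unt X) = idm (mfun X)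
}.

Record MonadMor (C : Category) (R T : Monad C) := MkMonadMor {
  mm_nat :> NatTrans R T;
  mm_mul : forall X,
    mm_nat X ∘ mul R X = mul T X ∘ mm_nat (T X) ∘ fmap R (mm_nat X);
  mm_unit : forall X, mm_nat X ∘ unt R X = unt T X
}.

Record is_module (C : Category) (R : Monad C) (X : C) (x : Hom (R X) X) : Prop := {
  module_mul : x ∘ fmap R x = x ∘ mul R X;
  module_unit : x ∘ unt R X = idm X
}.

Record is_distributive_law (C : Category) (R T : Monad C)
    (l : NatTrans (fcomp R T) (fcomp T R)) : Prop := {
  dl_mull : forall X,
    l X ∘ mul R (T X) = fmap T (mul R X) ∘ l (R X) ∘ fmap R (l X);
  dl_mulr : forall X,
    l X ∘ fmap R (mul T X) = mul T (R X) ∘ fmap T (l X) ∘ l (T X);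
  dl_unitl : forall X, l X ∘ unt R (T X) = fmap T (unt R X);
  dl_unitr : forall X, l X ∘ fmap R (unt T X) = unt T (R X)
}.

Record is_BD_law (C : Category) (T : Monad C)
    (t : NatTrans (fcomp T T) (fcomp T T)) : Prop := {
  bd_dl : is_distributive_law t;
  bd_yb : forall X, t (T X) ∘ fmap T (t X) ∘ t (T X)
                  = fmap T (t X) ∘ t (T X) ∘ fmap T (t X)
}.

(* The coequalizers of [C] come as an arbitrary choice [bp_coeq]; every
   construction below that is determined up to isomorphism uses this choice. *)
Record BraidedPair (C : Category) := MkBraidedPair {
  bp_coeq : forall (X Y : C) (f g : Hom X Y), Coequalizer f g;
  bp_T : Monad C;
  bp_R : Monad C;
  bp_presT : preserves_coequalizers bp_T;
  bp_presR : preserves_coequalizers bp_R;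
  bp_l : NatIso (fcomp bp_R bp_T) (fcomp bp_T bp_R);
  bp_t : NatIso (fcomp bp_T bp_T) (fcomp bp_T bp_T);
  bp_r : NatIso (fcomp bp_R bp_R) (fcomp bp_R bp_R);
  bp_ldl : is_distributive_law bp_l;
  bp_tbd : is_BD_law bp_t;
  bp_rbd : is_BD_law bp_r;
  bp_A1 : forall X,
    fmap bp_T (bp_r X) ∘ bp_l (bp_R X) ∘ fmap bp_R (bp_l X)
    = bp_l (bp_R X) ∘ fmap bp_R (bp_l X) ∘ bp_r (bp_T X);
  bp_A2 : forall X,
    bp_t (bp_R X) ∘ fmap bp_T (bp_l X) ∘ bp_l (bp_T X)
    = fmap bp_T (bp_l X) ∘ bp_l (bp_T X) ∘ fmap bp_R (bp_t X)
}.

Record BraidPreservingMor (C : Category) (S : BraidedPair C) := MkBraidPreservingMor {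
  bpm :> MonadMor (bp_R S) (bp_T S);
  bpm_A3l : forall X,
    bpm (bp_R S X) ∘ bp_r S X = bp_l S X ∘ fmap (bp_R S) (bpm X);
  bpm_A3r : forall X,
    fmap (bp_R S) (bpm X) ∘ bp_r S X = iso_inv (bp_l S) X ∘ bpm (bp_R S X);
  bpm_A4l : forall X,
    bp_t S X ∘ bpm (bp_T S X) = fmap (bp_T S) (bpm X) ∘ bp_l S X;
  bpm_A4r : forall X,
    bp_t S X ∘ fmap (bp_T S) (bpm X) = bpm (bp_T S X) ∘ iso_inv (bp_l S) X
}.

Section Reassoc.
Context (C : Category).

Lemma pre2 (X Y Y' Z : C) (a : Hom Y Z) (b : Hom X Y) (c : Hom Y' Z) (d : Hom X Y') :
  a ∘ b = c ∘ d -> forall W (h : Hom W X), a ∘ b ∘ h = c ∘ d ∘ h.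
Proof. by move=> E W h; rewrite !comp_assoc E. Qed.

Lemma pre21 (X Y Z : C) (a : Hom Y Z) (b : Hom X Y) (c : Hom X Z) :
  a ∘ b = c -> forall W (h : Hom W X), a ∘ b ∘ h = c ∘ h.
Proof. by move=> <- W h; rewrite !comp_assoc. Qed.

Lemma pre23 (X Y Y1 Y2 Z : C) (a : Hom Y Z) (b : Hom X Y)
    (c : Hom Y2 Z) (d : Hom Y1 Y2) (e : Hom X Y1) :
  a ∘ b = c ∘ d ∘ e -> forall W (h : Hom W X), a ∘ b ∘ h = c ∘ d ∘ e ∘ h.
Proof. by move=> E W h; rewrite !comp_assoc E !comp_assoc. Qed.

Lemma pre33 (X Y1 Y2 Y3 Y4 Z : C) (a : Hom Y2 Z) (b : Hom Y1 Y2) (c : Hom X Y1)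
    (a' : Hom Y4 Z) (b' : Hom Y3 Y4) (c' : Hom X Y3) :
  a ∘ b ∘ c = a' ∘ b' ∘ c' ->
  forall W (h : Hom W X), a ∘ b ∘ c ∘ h = a' ∘ b' ∘ c' ∘ h.
Proof.
by move=> E W h; rewrite !comp_assoc -(comp_assoc a) E !comp_assoc.
Qed.

Lemma pre31 (X Y1 Y2 Z : C) (a : Hom Y2 Z) (b : Hom Y1 Y2) (c : Hom X Y1) (d : Hom X Z) :
  a ∘ b ∘ c = d -> forall W (h : Hom W X), a ∘ b ∘ c ∘ h = d ∘ h.
Proof. by move=> <- W h; rewrite !comp_assoc. Qed.

Lemma pre32 (X Y1 Y2 Y3 Z : C) (a : Hom Y2 Z) (b : Hom Y1 Y2) (c : Hom X Y1)
    (d : Hom Y3 Z) (e : Hom X Y3) :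
  a ∘ b ∘ c = d ∘ e -> forall W (h : Hom W X), a ∘ b ∘ c ∘ h = d ∘ e ∘ h.
Proof. by move=> E W h; rewrite (comp_assoc d) -E !comp_assoc. Qed.
End Reassoc.

Section ReassocMap.
Context (C D : Category) (F : Functor C D).

Lemma map2 (X Y Y' Z : C) (a : Hom Y Z) (b : Hom X Y) (c : Hom Y' Z) (d : Hom X Y') :
  a ∘ b = c ∘ d -> fmap F a ∘ fmap F b = fmap F c ∘ fmap F d.
Proof. by move=> E; rewrite -!fmap_comp E. Qed.

Lemma map21 (X Y Z : C) (a : Hom Y Z) (b : Hom X Y) (c : Hom X Z) :
  a ∘ b = c -> fmap F a ∘ fmap F b = fmap F c.
Proof. by move=> E; rewrite -!fmap_comp E. Qed.

Lemma map23 (X Y Y1 Y2 Z : C) (a : Hom Y Z) (b : Hom X Y)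
    (c : Hom Y2 Z) (d : Hom Y1 Y2) (e : Hom X Y1) :
  a ∘ b = c ∘ d ∘ e ->
  fmap F a ∘ fmap F b = fmap F c ∘ fmap F d ∘ fmap F e.
Proof. by move=> E; rewrite -!fmap_comp E. Qed.

Lemma map33 (X Y1 Y2 Y3 Y4 Z : C) (a : Hom Y2 Z) (b : Hom Y1 Y2) (c : Hom X Y1)
    (a' : Hom Y4 Z) (b' : Hom Y3 Y4) (c' : Hom X Y3) :
  a ∘ b ∘ c = a' ∘ b' ∘ c' ->
  fmap F a ∘ fmap F b ∘ fmap F c = fmap F a' ∘ fmap F b' ∘ fmap F c'.
Proof. by move=> E; rewrite -!fmap_comp E. Qed.

Lemma map31 (X Y1 Y2 Z : C) (a : Hom Y2 Z) (b : Hom Y1 Y2) (c : Hom X Y1) (d : Hom X Z) :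
  a ∘ b ∘ c = d -> fmap F a ∘ fmap F b ∘ fmap F c = fmap F d.
Proof. by move=> E; rewrite -!fmap_comp E. Qed.
End ReassocMap.

Section TwistedMonad.
Context (C : Category) (R : Monad C) (r : NatTrans (fcomp R R) (fcomp R R)).
Context (bd : is_BD_law r).

Lemma twist_nat X Y (f : Hom X Y) :
  (mul R Y ∘ r Y) ∘ fmap (fcomp R R) f = fmap R f ∘ (mul R X ∘ r X).
Proof.
by rewrite -comp_assoc naturality comp_assoc (naturality (mul R)) -comp_assoc.
Qed.

Definition twist_mul : NatTrans (fcomp R R) R := MkNatTrans twist_nat.

Lemma twist_assoc X :
  twist_mul X ∘ fmap R (twist_mul X) = twist_mul X ∘ twist_mul (R X).
Proof.
case: bd => -[ml mr _ _] yb; rewrite /= fmap_comp -!comp_assoc.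
rewrite (pre23 (mr X)) (pre23 (ml X)) yb.
by rewrite !(pre2 (mul_assoc R X)).
Qed.

Lemma twist_unitl X : twist_mul X ∘ unt R (R X) = idm (R X).
Proof. by case: bd => -[_ _ ul _] _; rewrite /= -comp_assoc ul mul_unitr. Qed.

Lemma twist_unitr X : twist_mul X ∘ fmap R (unt R X) = idm (R X).
Proof. by case: bd => -[_ _ _ ur] _; rewrite /= -comp_assoc ur mul_unitl. Qed.

Definition twist : Monad C := MkMonad twist_assoc twist_unitl twist_unitr.
End TwistedMonad.

Section BimoduleCategory.
Context (C : Category) (S : BraidedPair C).
Local Notation R := (bp_R S).
Local Notation r := (bp_r S).

Definition Rtw : Monad C := twist (bp_rbd S).

Record Bimodule := MkBimodule {
  bcar :> C;
  lact : Hom (R bcar) bcar;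
  ract : Hom (R bcar) bcar;
  lact_module : is_module (R := R) lact;
  ract_module : is_module (R := Rtw) ract;
  bimodule_compat : lact ∘ fmap R ract ∘ r bcar = ract ∘ fmap R lact
}.

Record BimoduleHom (X Y : Bimodule) := MkBimoduleHom {
  bmor :> Hom (bcar X) (bcar Y);
  bmor_lact : bmor ∘ lact X = lact Y ∘ fmap R bmor;
  bmor_ract : bmor ∘ ract X = ract Y ∘ fmap R bmor
}.

Lemma bhom_eq X Y (f g : BimoduleHom X Y) : bmor f = bmor g -> f = g.
Proof.
case: f g => f f1 f2 [g g1 g2] /= E; subst g.
by rewrite (proof_irrelevance _ f1 g1) (proof_irrelevance _ f2 g2).
Qed.

Lemma bid_act (X : Bimodule) (x : Hom (R X) X) : idm X ∘ x = x ∘ fmap R (idm X).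
Proof. by rewrite fmap_id comp_idl comp_idr. Qed.

Definition bid (X : Bimodule) : BimoduleHom X X :=
  MkBimoduleHom (bid_act (lact X)) (bid_act (ract X)).

Section BComp.
Context (X Y Z : Bimodule) (g : BimoduleHom Y Z) (f : BimoduleHom X Y).

Lemma bcomp_lact : (g ∘ f) ∘ lact X = lact Z ∘ fmap R (g ∘ f).
Proof. by rewrite fmap_comp -comp_assoc bmor_lact (pre2 (bmor_lact g)). Qed.

Lemma bcomp_ract : (g ∘ f) ∘ ract X = ract Z ∘ fmap R (g ∘ f).
Proof. by rewrite fmap_comp -comp_assoc bmor_ract (pre2 (bmor_ract g)). Qed.

Definition bcomp : BimoduleHom X Z := MkBimoduleHom bcomp_lact bcomp_ract.
End BComp.

Lemma bcomp_idl X Y (f : BimoduleHom X Y) : bcomp (bid Y) f = f.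
Proof. by apply: bhom_eq; apply: comp_idl. Qed.

Lemma bcomp_idr X Y (f : BimoduleHom X Y) : bcomp f (bid X) = f.
Proof. by apply: bhom_eq; apply: comp_idr. Qed.

Lemma bcomp_assoc X Y Z W (h : BimoduleHom Z W) (g : BimoduleHom Y Z)
  (f : BimoduleHom X Y) : bcomp h (bcomp g f) = bcomp (bcomp h g) f.
Proof. by apply: bhom_eq; apply: comp_assoc. Qed.

Definition BimodCat : Category := MkCategory bcomp_idl bcomp_idr bcomp_assoc.

(* A morphism out of a quotient bimodule is a bimodule morphism as soon as
   its composite with the projection is one. *)
Lemma bdesc_act (A Q B : C) (a : Hom (R A) A) (x : Hom (R Q) Q) (b : Hom (R B) B)
    (q : Hom A Q) (g : Hom A B) (f : Hom Q B) :
  (forall Z (k k' : Hom (R Q) Z), k ∘ fmap R q = k' ∘ fmap R q -> k = k') ->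
  q ∘ a = x ∘ fmap R q -> g ∘ a = b ∘ fmap R g -> f ∘ q = g ->
  f ∘ x = b ∘ fmap R f.
Proof.
move=> epi Eq Eg E; apply: epi.
by rewrite -!comp_assoc -Eq -fmap_comp E -Eg comp_assoc E.
Qed.

Section Quotient.
Context (Y : Bimodule) (W : C) (u v : Hom W Y) (Q : C) (q : Hom Y Q).
Context (cq : is_coequalizer u v q).
Context (El : (q ∘ lact Y) ∘ fmap R u = (q ∘ lact Y) ∘ fmap R v).
Context (Er : (q ∘ ract Y) ∘ fmap R u = (q ∘ ract Y) ∘ fmap R v).

Definition quot_lact : Hom (R Q) Q := coeq_desc (bp_presR S cq) El.
Definition quot_ract : Hom (R Q) Q := coeq_desc (bp_presR S cq) Er.

Lemma quot_lactE : q ∘ lact Y = quot_lact ∘ fmap R q.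
Proof. by rewrite /quot_lact coeq_descE. Qed.

Lemma quot_ractE : q ∘ ract Y = quot_ract ∘ fmap R q.
Proof. by rewrite /quot_ract coeq_descE. Qed.

Lemma quot_module (M : Monad C) (y : Hom (M Y) Y) (x : Hom (M Q) Q) :
  preserves_coequalizers M -> is_module y -> q ∘ y = x ∘ fmap M q -> is_module x.
Proof.
move=> pM [ym yu] E; split.
- apply: (coeq_epi (pM _ _ _ _ _ _ (pM _ _ _ _ _ _ cq))).
  rewrite -!comp_assoc (naturality (mul M) q) -fmap_comp -E fmap_comp.
  by rewrite !(comp_assoc x) -E -!comp_assoc ym.
- apply: (coeq_epi cq).
  by rewrite -!comp_assoc (naturality (unt M) q) (comp_assoc x) -E -comp_assoc yu
    comp_idl comp_idr.
Qed.

Lemma quot_compat : quot_lact ∘ fmap R quot_ract ∘ r Q = quot_ract ∘ fmap R quot_lact.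
Proof.
have pR := bp_presR S.
apply: (coeq_epi (pR _ _ _ _ _ _ (pR _ _ _ _ _ _ cq))).
rewrite -!comp_assoc (naturality r q) /= (pre2 (map2 R (eq_sym quot_ractE))).
rewrite (pre2 (eq_sym quot_lactE)) -fmap_comp -quot_lactE fmap_comp.
by rewrite (pre2 (eq_sym quot_ractE)) -(bimodule_compat Y).
Qed.

Definition quot : Bimodule :=
  MkBimodule (quot_module (bp_presR S) (lact_module Y) quot_lactE)
    (@quot_module Rtw _ _ (bp_presR S) (ract_module Y) quot_ractE) quot_compat.

Definition quot_proj : BimoduleHom Y quot :=
  @MkBimoduleHom Y quot q quot_lactE quot_ractE.
End Quotient.

Section PiFunctor.

Definition Pi_coeq (X : Bimodule) : Coequalizer (lact X) (ract X) :=
  bp_coeq S (lact X) (ract X).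

Definition Pi_ob (X : Bimodule) : C := coeq_ob (Pi_coeq X).
Definition Pi_p (X : Bimodule) : Hom X (Pi_ob X) := coeq_map (Pi_coeq X).

Lemma Pi_p_coequalizer X : is_coequalizer (lact X) (ract X) (Pi_p X).
Proof. exact: coeqP. Qed.

Lemma Pi_map_eq X Y (f : BimoduleHom X Y) :
  (Pi_p Y ∘ f) ∘ lact X = (Pi_p Y ∘ f) ∘ ract X.
Proof.
rewrite -?comp_assoc bmor_lact bmor_ract !comp_assoc.
by rewrite (coeq_eq (Pi_p_coequalizer Y)).
Qed.

Definition Pi_map X Y (f : BimoduleHom X Y) : Hom (Pi_ob X) (Pi_ob Y) :=
  coeq_desc (Pi_p_coequalizer X) (Pi_map_eq f).

Lemma Pi_mapE X Y (f : BimoduleHom X Y) : Pi_map f ∘ Pi_p X = Pi_p Y ∘ f.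
Proof. exact: coeq_descE. Qed.

Lemma Pi_map_id X : Pi_map (bid X) = idm (Pi_ob X).
Proof.
apply: (coeq_epi (Pi_p_coequalizer X)).
by rewrite Pi_mapE comp_idl comp_idr.
Qed.

Lemma Pi_map_comp X Y Z (g : BimoduleHom Y Z) (f : BimoduleHom X Y) :
  Pi_map (bcomp g f) = Pi_map g ∘ Pi_map f.
Proof.
apply: (coeq_epi (Pi_p_coequalizer X)).
by rewrite Pi_mapE -comp_assoc Pi_mapE (pre2 (Pi_mapE g)).
Qed.

Definition Pi : Functor BimodCat C :=
  @MkFunctor BimodCat C Pi_ob Pi_map Pi_map_id Pi_map_comp.
End PiFunctor.
End BimoduleCategory.

Section Constructions.
Context (C : Category) (S : BraidedPair C) (phi : BraidPreservingMor S).
Local Notation R := (bp_R S).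
Local Notation T := (bp_T S).
Local Notation l := (bp_l S).
Local Notation t := (bp_t S).
Local Notation r := (bp_r S).
Local Notation li := (iso_inv (bp_l S)).
Local Notation muT := (mul (bp_T S)).
Local Notation muR := (mul (bp_R S)).
Local Notation tau := (unt (bp_T S)).
Local Notation rho := (unt (bp_R S)).
Local Notation B := (BimodCat S).

Lemma phiN X Y (f : Hom X Y) : phi Y ∘ fmap R f = fmap T f ∘ phi X.
Proof. exact: naturality. Qed.

Lemma lN X Y (f : Hom X Y) :
  l Y ∘ fmap R (fmap T f) = fmap T (fmap R f) ∘ l X.
Proof. exact: (naturality l f). Qed.

Lemma liN X Y (f : Hom X Y) :
  li Y ∘ fmap T (fmap R f) = fmap R (fmap T f) ∘ li X.
Proof. exact: (naturality li f). Qed.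

Lemma tN X Y (f : Hom X Y) :
  t Y ∘ fmap T (fmap T f) = fmap T (fmap T f) ∘ t X.
Proof. exact: (naturality t f). Qed.

Lemma rN X Y (f : Hom X Y) :
  r Y ∘ fmap R (fmap R f) = fmap R (fmap R f) ∘ r X.
Proof. exact: (naturality r f). Qed.

Lemma muTN X Y (f : Hom X Y) : muT Y ∘ fmap T (fmap T f) = fmap T f ∘ muT X.
Proof. exact: (naturality muT f). Qed.

Lemma muRN X Y (f : Hom X Y) : muR Y ∘ fmap R (fmap R f) = fmap R f ∘ muR X.
Proof. exact: (naturality muR f). Qed.

Lemma tauN X Y (f : Hom X Y) : tau Y ∘ f = fmap T f ∘ tau X.
Proof. exact: (naturality tau f). Qed.

Lemma rhoN X Y (f : Hom X Y) : rho Y ∘ f = fmap R f ∘ rho X.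
Proof. exact: (naturality rho f). Qed.

Lemma l_mulR X : l X ∘ muR (T X) = fmap T (muR X) ∘ l (R X) ∘ fmap R (l X).
Proof. by case: (bp_ldl S). Qed.

Lemma l_mulT X : l X ∘ fmap R (muT X) = muT (R X) ∘ fmap T (l X) ∘ l (T X).
Proof. by case: (bp_ldl S). Qed.

Lemma l_rho X : l X ∘ rho (T X) = fmap T (rho X).
Proof. by case: (bp_ldl S). Qed.

Lemma l_tau X : l X ∘ fmap R (tau X) = tau (R X).
Proof. by case: (bp_ldl S). Qed.

Lemma t_mull X : t X ∘ muT (T X) = fmap T (muT X) ∘ t (T X) ∘ fmap T (t X).
Proof. by case: (bp_tbd S) => -[]. Qed.

Lemma t_mulr X : t X ∘ fmap T (muT X) = muT (T X) ∘ fmap T (t X) ∘ t (T X).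
Proof. by case: (bp_tbd S) => -[]. Qed.

Lemma liK X : li X ∘ l X = idm (R (T X)).
Proof. exact: (iso_invK l X). Qed.

Lemma lK X : l X ∘ li X = idm (T (R X)).
Proof. exact: (iso_homK l X). Qed.

Lemma l_Rphi X : l X ∘ fmap R (phi X) = phi (R X) ∘ r X.
Proof. by rewrite bpm_A3l. Qed.

Lemma l_Rphi_r X : l X ∘ fmap R (phi X) ∘ r X = phi (R X).
Proof. by rewrite bpm_A3r comp_assoc lK comp_idl. Qed.

Lemma t_Tphi_l X : t X ∘ fmap T (phi X) ∘ l X = phi (T X).
Proof. by rewrite (pre2 (bpm_A4r phi X)) liK comp_idr. Qed.

Lemma l_epi X Z (k k' : Hom (T (R X)) Z) : k ∘ l X = k' ∘ l X -> k = k'.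
Proof.
by move=> E; rewrite -(comp_idr k) -(comp_idr k') -(lK X) !comp_assoc E.
Qed.

Lemma r_epi X Z (k k' : Hom (R (R X)) Z) : k ∘ r X = k' ∘ r X -> k = k'.
Proof.
move=> E; rewrite -(comp_idr k) -(comp_idr k') -(iso_homK (bp_r S) X) /=.
by rewrite !comp_assoc E.
Qed.

Section T_i.
Context (X : Bimodule S).

Definition xi : Hom (R (T X)) (T X) := fmap T (lact X) ∘ l X.
Definition xi0 : Hom (R (T X)) (T X) := muT X ∘ fmap T (phi X) ∘ l X.
Definition xo : Hom (R (T X)) (T X) := muT X ∘ phi (T X).
Definition xo0 : Hom (R (T X)) (T X) := fmap T (ract X) ∘ l X.

Lemma lact_mul : lact X ∘ fmap R (lact X) = lact X ∘ muR X.
Proof. by case: (lact_module X). Qed.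

Lemma lact_unit : lact X ∘ rho X = idm X.
Proof. by case: (lact_module X). Qed.

Lemma ract_mul : ract X ∘ fmap R (ract X) = ract X ∘ muR X ∘ r X.
Proof. by case: (ract_module X). Qed.

Lemma ract_unit : ract X ∘ rho X = idm X.
Proof. by case: (ract_module X). Qed.

Lemma xi_module : is_module (R := R) xi.
Proof.
split; rewrite /xi ?fmap_comp -?comp_assoc.
- rewrite (pre2 (lN _)) (pre2 (map2 T lact_mul)) l_mulR.
  by [].
- by rewrite l_rho (map21 T lact_unit) fmap_id.
Qed.

Lemma xi0_module : is_module (R := Rtw S) xi0.
Proof.
split; rewrite /= /xi0 ?fmap_comp -?comp_assoc.
- rewrite (pre2 (l_mulR X)) -?comp_assoc -bp_A1.
  rewrite (pre23 (map23 T (mm_mul phi X))) -?comp_assoc (pre2 (map2 T (phiN (phi X)))).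
  rewrite (pre23 (l_mulT X)) (pre2 (lN (phi X))) (pre2 (map2 T (l_Rphi X))).
  by rewrite -(pre2 (muTN (phi X))) -(pre2 (mul_assoc T X)).
- rewrite l_rho (map21 T (mm_unit phi X)).
  exact: mul_unitr.
Qed.

Lemma xi_compat : xi ∘ fmap R xi0 ∘ r (T X) = xi0 ∘ fmap R xi.
Proof.
rewrite /xi /xi0 ?fmap_comp -?comp_assoc.
rewrite (pre23 (l_mulT X)) (pre2 (lN (phi X))) -bp_A1 -?comp_assoc.
rewrite (pre31 (map31 T (l_Rphi_r X))).
rewrite (pre2 (lN (lact X))) (pre2 (map2 T (phiN (lact X)))).
by rewrite (pre2 (muTN (lact X))).
Qed.

Definition T_i_ob : Bimodule S := MkBimodule xi_module xi0_module xi_compat.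

Lemma xo_module : is_module (R := R) xo.
Proof.
split; rewrite /xo ?fmap_comp -?comp_assoc.
- rewrite mm_mul (pre2 (phiN (muT X))) (pre2 (mul_assoc T X)).
  by rewrite (phiN (phi (T X))).
- by rewrite mm_unit mul_unitl.
Qed.

Lemma xo0_module : is_module (R := Rtw S) xo0.
Proof.
split; rewrite /= /xo0 ?fmap_comp -?comp_assoc.
- rewrite (pre2 (lN _)) (pre2 (map23 T ract_mul)) -?comp_assoc bp_A1.
  by rewrite (pre2 (l_mulR X)) -?comp_assoc.
- by rewrite l_rho (map21 T ract_unit) fmap_id.
Qed.

Lemma xo_compat : xo ∘ fmap R xo0 ∘ r (T X) = xo0 ∘ fmap R xo.
Proof.
rewrite /xo /xo0 ?fmap_comp -?comp_assoc.
rewrite (pre2 (phiN (fmap T (ract X)))) (pre2 (muTN (ract X))).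
rewrite (pre2 (phiN (l X))) bpm_A3l.
by rewrite (pre23 (l_mulT X)).
Qed.

Definition T_o_ob : Bimodule S := MkBimodule xo_module xo0_module xo_compat.

(* The actions of [T_o_ob] descend along the actions of [T_i_ob] and vice versa *)

Lemma xo_xi : xo ∘ fmap R xi = xi ∘ fmap R xo ∘ r (T X).
Proof.
rewrite /xo /xi ?fmap_comp -?comp_assoc.
rewrite (pre2 (phiN (fmap T (lact X)))) (pre2 (muTN (lact X))).
rewrite (phiN (l X)) -l_Rphi_r.
by rewrite (pre23 (l_mulT X)).
Qed.

Lemma xo_xi0 : xo ∘ fmap R xi0 = xi0 ∘ fmap R xo ∘ r (T X).
Proof.
rewrite /xo /xi0 ?fmap_comp -?comp_assoc.
rewrite (pre2 (phiN (muT X))) (pre2 (phiN (fmap T (phi X)))) (phiN (l X)).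
rewrite -l_Rphi_r (pre23 (l_mulT X)) -(pre2 (muTN (phi X))).
by rewrite (pre2 (mul_assoc T X)).
Qed.

Lemma xo0_xi : xo0 ∘ fmap R xi = xi ∘ fmap R xo0 ∘ r (T X).
Proof.
rewrite /xo0 /xi ?fmap_comp -?comp_assoc.
rewrite (pre2 (lN (lact X))) (pre23 (map23 T (eq_sym (bimodule_compat X)))).
by rewrite bp_A1 (pre2 (lN (ract X))).
Qed.

Lemma xo0_xi0 : xo0 ∘ fmap R xi0 = xi0 ∘ fmap R xo0 ∘ r (T X).
Proof.
rewrite /xo0 /xi0 ?fmap_comp -?comp_assoc.
rewrite (pre23 (l_mulT X)) (pre2 (lN (phi X))) (pre2 (map2 T (l_Rphi X))) bp_A1.
rewrite (pre2 (lN (ract X))) (pre2 (map2 T (phiN (ract X)))).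
by rewrite (pre2 (muTN (ract X))).
Qed.
End T_i.

Section TiMor.
Context (X Y : Bimodule S) (f : BimoduleHom X Y).

Lemma Tf_xi : fmap T f ∘ xi X = xi Y ∘ fmap R (fmap T f).
Proof. by rewrite /xi -comp_assoc lN (pre2 (map2 T (bmor_lact f))). Qed.

Lemma Tf_xi0 : fmap T f ∘ xi0 X = xi0 Y ∘ fmap R (fmap T f).
Proof.
by rewrite /xi0 -!comp_assoc lN (pre2 (map2 T (phiN f))) (pre2 (muTN f)).
Qed.

Lemma Tf_xo : fmap T f ∘ xo X = xo Y ∘ fmap R (fmap T f).
Proof. by rewrite /xo -comp_assoc phiN (pre2 (muTN f)). Qed.

Lemma Tf_xo0 : fmap T f ∘ xo0 X = xo0 Y ∘ fmap R (fmap T f).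
Proof. by rewrite /xo0 -comp_assoc lN (pre2 (map2 T (bmor_ract f))). Qed.

Definition T_i_map : BimoduleHom (T_i_ob X) (T_i_ob Y) :=
  @MkBimoduleHom C S (T_i_ob X) (T_i_ob Y) (fmap T f) Tf_xi Tf_xi0.

Definition T_o_map : BimoduleHom (T_o_ob X) (T_o_ob Y) :=
  @MkBimoduleHom C S (T_o_ob X) (T_o_ob Y) (fmap T f) Tf_xo Tf_xo0.
End TiMor.

Lemma T_i_map_id X : T_i_map (bid X) = bid (T_i_ob X).
Proof. by apply: bhom_eq; apply: fmap_id. Qed.

Lemma T_i_map_comp X Y Z (g : BimoduleHom Y Z) (f : BimoduleHom X Y) :
  T_i_map (bcomp g f) = bcomp (T_i_map g) (T_i_map f).
Proof. by apply: bhom_eq; apply: fmap_comp. Qed.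

Lemma T_o_map_id X : T_o_map (bid X) = bid (T_o_ob X).
Proof. by apply: bhom_eq; apply: fmap_id. Qed.

Lemma T_o_map_comp X Y Z (g : BimoduleHom Y Z) (f : BimoduleHom X Y) :
  T_o_map (bcomp g f) = bcomp (T_o_map g) (T_o_map f).
Proof. by apply: bhom_eq; apply: fmap_comp. Qed.

Definition T_i : Functor B B := @MkFunctor B B T_i_ob T_i_map T_i_map_id T_i_map_comp.
Definition T_o : Functor B B := @MkFunctor B B T_o_ob T_o_map T_o_map_id T_o_map_comp.

Section Tbar.
Context (X : Bimodule S).

Definition pi_o_coeq : Coequalizer (xi X) (xi0 X) := bp_coeq S (xi X) (xi0 X).
Definition pi_i_coeq : Coequalizer (xo X) (xo0 X) := bp_coeq S (xo X) (xo0 X).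

Lemma pi_o_coequalizer : is_coequalizer (xi X) (xi0 X) (coeq_map pi_o_coeq).
Proof. exact: coeqP. Qed.

Lemma pi_i_coequalizer : is_coequalizer (xo X) (xo0 X) (coeq_map pi_i_coeq).
Proof. exact: coeqP. Qed.

Lemma pi_o_lact : (coeq_map pi_o_coeq ∘ xo X) ∘ fmap R (xi X)
  = (coeq_map pi_o_coeq ∘ xo X) ∘ fmap R (xi0 X).
Proof.
by rewrite -!(comp_assoc (coeq_map _)) xo_xi xo_xi0 (pre2 (coeq_eq pi_o_coequalizer)).
Qed.

Lemma pi_o_ract : (coeq_map pi_o_coeq ∘ xo0 X) ∘ fmap R (xi X)
  = (coeq_map pi_o_coeq ∘ xo0 X) ∘ fmap R (xi0 X).
Proof.
by rewrite -!(comp_assoc (coeq_map _)) xo0_xi xo0_xi0 (pre2 (coeq_eq pi_o_coequalizer)).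
Qed.

Lemma pi_i_lact : (coeq_map pi_i_coeq ∘ xi X) ∘ fmap R (xo X)
  = (coeq_map pi_i_coeq ∘ xi X) ∘ fmap R (xo0 X).
Proof.
apply: r_epi.
rewrite -!(comp_assoc (coeq_map _)).
by rewrite -(comp_assoc (xi X)) -(comp_assoc (xi X)) -xo_xi -xo0_xi
  (pre2 (coeq_eq pi_i_coequalizer)).
Qed.

Lemma pi_i_ract : (coeq_map pi_i_coeq ∘ xi0 X) ∘ fmap R (xo X)
  = (coeq_map pi_i_coeq ∘ xi0 X) ∘ fmap R (xo0 X).
Proof.
apply: r_epi.
rewrite -!(comp_assoc (coeq_map _)).
by rewrite -(comp_assoc (xi0 X)) -(comp_assoc (xi0 X)) -xo_xi0 -xo0_xi0
  (pre2 (coeq_eq pi_i_coequalizer)).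
Qed.

Definition Tbar_o_ob : Bimodule S := quot (Y := T_o_ob X) pi_o_coequalizer pi_o_lact pi_o_ract.
Definition Tbar_i_ob : Bimodule S := quot (Y := T_i_ob X) pi_i_coequalizer pi_i_lact pi_i_ract.

Definition pi_o_X : BimoduleHom (T_o_ob X) Tbar_o_ob :=
  quot_proj (Y := T_o_ob X) pi_o_coequalizer pi_o_lact pi_o_ract.
Definition pi_i_X : BimoduleHom (T_i_ob X) Tbar_i_ob :=
  quot_proj (Y := T_i_ob X) pi_i_coequalizer pi_i_lact pi_i_ract.

Lemma pi_oP : is_coequalizer (xi X) (xi0 X) pi_o_X.
Proof. exact: pi_o_coequalizer. Qed.

Lemma pi_iP : is_coequalizer (xo X) (xo0 X) pi_i_X.
Proof. exact: pi_i_coequalizer. Qed.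

Section BDesc.
Context (Y : Bimodule S).

Lemma pi_o_bdesc (g : BimoduleHom (T_o_ob X) Y) (f : Hom Tbar_o_ob Y) (E : f ∘ pi_o_X = g) :
  f ∘ lact Tbar_o_ob = lact Y ∘ fmap R f /\ f ∘ ract Tbar_o_ob = ract Y ∘ fmap R f.
Proof.
have epi := coeq_epi (bp_presR S pi_oP).
split.
- exact: (bdesc_act epi (bmor_lact pi_o_X) (bmor_lact g) E).
- exact: (bdesc_act epi (bmor_ract pi_o_X) (bmor_ract g) E).
Qed.

Lemma pi_i_bdesc (g : BimoduleHom (T_i_ob X) Y) (f : Hom Tbar_i_ob Y) (E : f ∘ pi_i_X = g) :
  f ∘ lact Tbar_i_ob = lact Y ∘ fmap R f /\ f ∘ ract Tbar_i_ob = ract Y ∘ fmap R f.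
Proof.
have epi := coeq_epi (bp_presR S pi_iP).
split.
- exact: (bdesc_act epi (bmor_lact pi_i_X) (bmor_lact g) E).
- exact: (bdesc_act epi (bmor_ract pi_i_X) (bmor_ract g) E).
Qed.

Definition pi_o_desc (g : BimoduleHom (T_o_ob X) Y) (E : g ∘ xi X = g ∘ xi0 X) :
    BimoduleHom Tbar_o_ob Y :=
  let: conj fl fr := pi_o_bdesc (coeq_descE pi_oP E) in MkBimoduleHom fl fr.

Lemma pi_o_descE (g : BimoduleHom (T_o_ob X) Y) (E : g ∘ xi X = g ∘ xi0 X) : pi_o_desc E ∘ pi_o_X = g.
Proof. by rewrite /pi_o_desc; case: pi_o_bdesc => fl fr; apply: coeq_descE. Qed.

Definition pi_i_desc (g : BimoduleHom (T_i_ob X) Y) (E : g ∘ xo X = g ∘ xo0 X) :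
    BimoduleHom Tbar_i_ob Y :=
  let: conj fl fr := pi_i_bdesc (coeq_descE pi_iP E) in MkBimoduleHom fl fr.

Lemma pi_i_descE (g : BimoduleHom (T_i_ob X) Y) (E : g ∘ xo X = g ∘ xo0 X) : pi_i_desc E ∘ pi_i_X = g.
Proof. by rewrite /pi_i_desc; case: pi_i_bdesc => fl fr; apply: coeq_descE. Qed.
End BDesc.
End Tbar.

Lemma pi_o_eq X : pi_o_X X ∘ xi X = pi_o_X X ∘ xi0 X.
Proof. exact: coeq_eq (pi_oP X). Qed.

Lemma pi_i_eq X : pi_i_X X ∘ xo X = pi_i_X X ∘ xo0 X.
Proof. exact: coeq_eq (pi_iP X). Qed.

Section TbarMor.
Context (X Y : Bimodule S) (f : BimoduleHom X Y).

Lemma Tbar_o_map_eq : bcomp (pi_o_X Y) (T_o_map f) ∘ xi X = bcomp (pi_o_X Y) (T_o_map f) ∘ xi0 X.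
Proof.
rewrite /= -(comp_assoc (pi_o_X Y)) -(comp_assoc (pi_o_X Y)) Tf_xi Tf_xi0.
by rewrite (pre2 (pi_o_eq Y)).
Qed.

Lemma Tbar_i_map_eq : bcomp (pi_i_X Y) (T_i_map f) ∘ xo X = bcomp (pi_i_X Y) (T_i_map f) ∘ xo0 X.
Proof.
rewrite /= -(comp_assoc (pi_i_X Y)) -(comp_assoc (pi_i_X Y)) Tf_xo Tf_xo0.
by rewrite (pre2 (pi_i_eq Y)).
Qed.

Definition Tbar_o_map : BimoduleHom (Tbar_o_ob X) (Tbar_o_ob Y) := pi_o_desc Tbar_o_map_eq.
Definition Tbar_i_map : BimoduleHom (Tbar_i_ob X) (Tbar_i_ob Y) := pi_i_desc Tbar_i_map_eq.

Lemma Tbar_o_mapE : Tbar_o_map ∘ pi_o_X X = pi_o_X Y ∘ fmap T f.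
Proof. exact: (pi_o_descE Tbar_o_map_eq). Qed.

Lemma Tbar_i_mapE : Tbar_i_map ∘ pi_i_X X = pi_i_X Y ∘ fmap T f.
Proof. exact: (pi_i_descE Tbar_i_map_eq). Qed.
End TbarMor.

Lemma Tbar_o_map_id X : Tbar_o_map (bid X) = bid (Tbar_o_ob X).
Proof.
apply: bhom_eq; apply: (coeq_epi (pi_oP X)).
by rewrite Tbar_o_mapE /= fmap_id comp_idl comp_idr.
Qed.

Lemma Tbar_o_map_comp X Y Z (g : BimoduleHom Y Z) (f : BimoduleHom X Y) :
  Tbar_o_map (bcomp g f) = bcomp (Tbar_o_map g) (Tbar_o_map f).
Proof.
apply: bhom_eq; apply: (coeq_epi (pi_oP X)).
by rewrite Tbar_o_mapE /= fmap_comp -comp_assoc Tbar_o_mapE (pre2 (Tbar_o_mapE g)).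
Qed.

Lemma Tbar_i_map_id X : Tbar_i_map (bid X) = bid (Tbar_i_ob X).
Proof.
apply: bhom_eq; apply: (coeq_epi (pi_iP X)).
by rewrite Tbar_i_mapE /= fmap_id comp_idl comp_idr.
Qed.

Lemma Tbar_i_map_comp X Y Z (g : BimoduleHom Y Z) (f : BimoduleHom X Y) :
  Tbar_i_map (bcomp g f) = bcomp (Tbar_i_map g) (Tbar_i_map f).
Proof.
apply: bhom_eq; apply: (coeq_epi (pi_iP X)).
by rewrite Tbar_i_mapE /= fmap_comp -comp_assoc Tbar_i_mapE (pre2 (Tbar_i_mapE g)).
Qed.

Definition Tbar_o : Functor B B := @MkFunctor B B Tbar_o_ob Tbar_o_map Tbar_o_map_id Tbar_o_map_comp.
Definition Tbar_i : Functor B B := @MkFunctor B B Tbar_i_ob Tbar_i_map Tbar_i_map_id Tbar_i_map_comp.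

Lemma pi_o_nat (X Y : B) (f : Hom X Y) :
  comp (c := B) (pi_o_X Y) (fmap T_o f) = comp (c := B) (fmap Tbar_o f) (pi_o_X X).
Proof. by apply: bhom_eq; rewrite /= Tbar_o_mapE. Qed.

Lemma pi_i_nat (X Y : B) (f : Hom X Y) :
  comp (c := B) (pi_i_X Y) (fmap T_i f) = comp (c := B) (fmap Tbar_i f) (pi_i_X X).
Proof. by apply: bhom_eq; rewrite /= Tbar_i_mapE. Qed.

Definition pi_o : NatTrans T_o Tbar_o := @MkNatTrans B B T_o Tbar_o pi_o_X pi_o_nat.
Definition pi_i : NatTrans T_i Tbar_i := @MkNatTrans B B T_i Tbar_i pi_i_X pi_i_nat.

Section TauBar.
Context (X : Bimodule S).

Lemma tau_bar_o_lact :
  (pi_o_X X ∘ tau X) ∘ lact X = lact (Tbar_o_ob X) ∘ fmap R (pi_o_X X ∘ tau X).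
Proof.
rewrite fmap_comp comp_assoc -(bmor_lact (pi_o_X X)) -(comp_assoc (pi_o_X X)).
rewrite -(comp_assoc (pi_o_X X)) tauN /= -(comp_assoc (muT X)).
rewrite phiN (pre21 (mul_unitr T X)) comp_idl.
have -> : phi X = xi0 X ∘ fmap R (tau X).
  rewrite /xi0 -!comp_assoc l_tau -tauN (pre21 (mul_unitl T X)).
  by rewrite comp_idl.
have -> : fmap T (lact X) ∘ tau (R X) = xi X ∘ fmap R (tau X).
  by rewrite /xi -comp_assoc l_tau.
by rewrite (pre2 (pi_o_eq X)).
Qed.

Lemma tau_bar_o_ract :
  (pi_o_X X ∘ tau X) ∘ ract X = ract (Tbar_o_ob X) ∘ fmap R (pi_o_X X ∘ tau X).
Proof.
rewrite fmap_comp comp_assoc -(bmor_ract (pi_o_X X)) -(comp_assoc (pi_o_X X)).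
by rewrite -(comp_assoc (pi_o_X X)) tauN /= /xo0 -(comp_assoc (fmap T _)) l_tau.
Qed.

Definition tau_bar_o_X : BimoduleHom X (Tbar_o_ob X) := MkBimoduleHom tau_bar_o_lact tau_bar_o_ract.
End TauBar.

Lemma tau_bar_o_nat (X Y : B) (f : Hom X Y) :
  comp (c := B) (tau_bar_o_X Y) (fmap (fid B) f) = comp (c := B) (fmap Tbar_o f) (tau_bar_o_X X).
Proof.
apply: bhom_eq => /=.
by rewrite -comp_assoc tauN (pre2 (Tbar_o_mapE f)).
Qed.

Definition tau_bar_o : NatTrans (fid B) Tbar_o := @MkNatTrans B B (fid B) Tbar_o tau_bar_o_X tau_bar_o_nat.

Section MulBar.
Context (X : Bimodule S).
Local Notation Q := (Tbar_o_ob X).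

Lemma muT_xi : muT X ∘ fmap T (xi X) ∘ l (T X) = xi X ∘ fmap R (muT X).
Proof.
rewrite /xi fmap_comp -!comp_assoc (pre2 (muTN (lact X))) l_mulT.
by [].
Qed.

Lemma muT_xi0 : muT X ∘ fmap T (xi0 X) ∘ l (T X) = xi0 X ∘ fmap R (muT X).
Proof.
rewrite /xi0 !fmap_comp -!comp_assoc (pre2 (mul_assoc T X)) (pre2 (muTN (phi X))).
by rewrite l_mulT.
Qed.

Lemma pi_o_mu_eq :
  (pi_o_X X ∘ muT X) ∘ fmap T (xi X) = (pi_o_X X ∘ muT X) ∘ fmap T (xi0 X).
Proof.
apply: l_epi; rewrite -!(comp_assoc (pi_o_X X)) -!(comp_assoc (muT X)).
by rewrite muT_xi muT_xi0 (pre2 (pi_o_eq X)).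
Qed.

Definition t_bar_o1 : Hom (T Q) Q := coeq_desc (bp_presT S (pi_oP X)) pi_o_mu_eq.

Lemma t_bar_o1E : t_bar_o1 ∘ fmap T (pi_o_X X) = pi_o_X X ∘ muT X.
Proof. exact: coeq_descE. Qed.

Lemma t_bar_o1_lact : t_bar_o1 ∘ xo Q = lact Q ∘ fmap R t_bar_o1.
Proof.
apply: (coeq_epi (bp_presR S (bp_presT S (pi_oP X)))).
rewrite -(comp_assoc t_bar_o1) -(comp_assoc (lact Q)) -fmap_comp t_bar_o1E fmap_comp.
rewrite (pre2 (eq_sym (bmor_lact (pi_o_X X)))) -(Tf_xo (pi_o_X X)) (pre2 t_bar_o1E).
rewrite /= /xo -?comp_assoc phiN (pre2 (mul_assoc T X)).
by [].
Qed.

Lemma t_bar_o1_ract : t_bar_o1 ∘ xo0 Q = ract Q ∘ fmap R t_bar_o1.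
Proof.
apply: (coeq_epi (bp_presR S (bp_presT S (pi_oP X)))).
rewrite -(comp_assoc t_bar_o1) -(comp_assoc (ract Q)) -fmap_comp t_bar_o1E fmap_comp.
rewrite (pre2 (eq_sym (bmor_ract (pi_o_X X)))) -(Tf_xo0 (pi_o_X X)) (pre2 t_bar_o1E).
rewrite /= /xo0 fmap_comp -?comp_assoc l_mulT (pre2 (muTN (ract X))).
by [].
Qed.

Definition t_bar_o1_hom : BimoduleHom (T_o_ob Q) Q :=
  @MkBimoduleHom C S (T_o_ob Q) Q t_bar_o1 t_bar_o1_lact t_bar_o1_ract.

Lemma t_bar_o1_eq : t_bar_o1_hom ∘ xi Q = t_bar_o1_hom ∘ xi0 Q.
Proof.
apply: (coeq_epi (bp_presR S (bp_presT S (pi_oP X)))).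
rewrite /= -!(comp_assoc t_bar_o1) -(Tf_xi0 (pi_o_X X)) (pre2 t_bar_o1E).
rewrite /xi -(comp_assoc (fmap T _)) lN.
rewrite (pre2 (map2 T (eq_sym (bmor_lact (pi_o_X X))))) (pre2 t_bar_o1E).
by rewrite /= /xi0 /xo fmap_comp -!comp_assoc (pre2 (mul_assoc T X)).
Qed.

Definition t_bar_o_X : BimoduleHom (Tbar_o_ob Q) Q := pi_o_desc t_bar_o1_eq.

Lemma t_bar_o_XE : t_bar_o_X ∘ pi_o_X Q ∘ fmap T (pi_o_X X) = pi_o_X X ∘ muT X.
Proof. by rewrite (pre21 (pi_o_descE t_bar_o1_eq)) t_bar_o1E. Qed.
End MulBar.

Lemma pi_o2_epi X Z (k k' : Hom (Tbar_o_ob (Tbar_o_ob X)) Z) :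
  k ∘ pi_o_X (Tbar_o_ob X) ∘ fmap T (pi_o_X X) = k' ∘ pi_o_X (Tbar_o_ob X) ∘ fmap T (pi_o_X X) ->
  k = k'.
Proof.
move=> E; apply: (coeq_epi (pi_oP _)); apply: (coeq_epi (bp_presT S (pi_oP X))).
by rewrite -!comp_assoc.
Qed.

Lemma t_bar_o_nat (X Y : B) (f : Hom X Y) :
  comp (c := B) (t_bar_o_X Y) (fmap (fcomp Tbar_o Tbar_o) f) = comp (c := B) (fmap Tbar_o f) (t_bar_o_X X).
Proof.
apply: bhom_eq; apply: pi_o2_epi; rewrite /= -!comp_assoc t_bar_o_XE.
rewrite (pre2 (Tbar_o_mapE (Tbar_o_map f))) -fmap_comp Tbar_o_mapE fmap_comp.
by rewrite (pre32 (t_bar_o_XE Y)) muTN (pre2 (Tbar_o_mapE f)).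
Qed.

Definition t_bar_o : NatTrans (fcomp Tbar_o Tbar_o) Tbar_o :=
  @MkNatTrans B B (fcomp Tbar_o Tbar_o) Tbar_o t_bar_o_X t_bar_o_nat.

Lemma t_bar_o_assoc X : bcomp (t_bar_o X) (Tbar_o_map (t_bar_o X)) = bcomp (t_bar_o X) (t_bar_o (Tbar_o_ob X)).
Proof.
apply: bhom_eq; apply: pi_o2_epi.
apply: (coeq_epi (bp_presT S (bp_presT S (pi_oP X)))).
rewrite /= -!comp_assoc (pre2 (Tbar_o_mapE (t_bar_o_X X))).
rewrite -!fmap_comp t_bar_o_XE !fmap_comp (pre32 (t_bar_o_XE X)).
rewrite (pre32 (t_bar_o_XE (Tbar_o_ob X))) muTN (pre32 (t_bar_o_XE X)).
by rewrite mul_assoc.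
Qed.

Lemma t_bar_o_unitl X : bcomp (t_bar_o X) (tau_bar_o (Tbar_o_ob X)) = bid (Tbar_o_ob X).
Proof.
apply: bhom_eq; apply: (coeq_epi (pi_oP X)).
rewrite /= -!comp_assoc tauN (pre32 (t_bar_o_XE X)) mul_unitl.
by rewrite comp_idl comp_idr.
Qed.

Lemma t_bar_o_unitr X : bcomp (t_bar_o X) (Tbar_o_map (tau_bar_o X)) = bid (Tbar_o_ob X).
Proof.
apply: bhom_eq; apply: (coeq_epi (pi_oP X)).
rewrite /= -!comp_assoc (Tbar_o_mapE (tau_bar_o_X X)) fmap_comp (pre32 (t_bar_o_XE X)) mul_unitr.
by rewrite comp_idl comp_idr.
Qed.

Definition Tbar_o_monad : Monad B := @MkMonad B Tbar_o t_bar_o tau_bar_o t_bar_o_assoc t_bar_o_unitl t_bar_o_unitr.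

Section TPrime.
Context (X : Bimodule S).

Lemma t_xi : t X ∘ fmap T (xi X) ∘ l (T X) = xi (T_i_ob X) ∘ fmap R (t X).
Proof.
rewrite /xi /= /xi !fmap_comp -!comp_assoc (pre2 (tN (lact X))).
by rewrite bp_A2.
Qed.

Lemma t_xi0 : t X ∘ fmap T (xi0 X) ∘ l (T X) = xi0 (T_i_ob X) ∘ fmap R (t X).
Proof.
rewrite /xi0 /= !fmap_comp -!comp_assoc (pre23 (t_mulr X)) (pre2 (tN (phi X))) bp_A2.
by rewrite (pre31 (map31 T (t_Tphi_l X))).
Qed.

Lemma t_lact : t X ∘ xi (T_o_ob X) = xo (T_i_ob X) ∘ fmap R (t X).
Proof.
rewrite /xi /xo /= /xo !fmap_comp -!comp_assoc (pre23 (t_mulr X)).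
by rewrite (t_Tphi_l (T X)) phiN.
Qed.

Lemma t_ract : t X ∘ xi0 (T_o_ob X) = xo0 (T_i_ob X) ∘ fmap R (t X).
Proof.
rewrite /xi0 /xo0 /= /xi0 !fmap_comp -!comp_assoc (pre23 (t_mull X)).
by rewrite (pre2 (map2 T (bpm_A4l phi X))) (pre2 (tN (phi X))) bp_A2.
Qed.

Lemma t_prime_eq :
  (pi_o_X (T_i_ob X) ∘ t X) ∘ fmap T (xi X) = (pi_o_X (T_i_ob X) ∘ t X) ∘ fmap T (xi0 X).
Proof.
apply: l_epi; rewrite -!(comp_assoc (pi_o_X _)) -!(comp_assoc (t X)) t_xi t_xi0.
by rewrite (pre2 (pi_o_eq (T_i_ob X))).
Qed.

Definition t_prime1 : Hom (T (Tbar_o_ob X)) (Tbar_o_ob (T_i_ob X)) :=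
  coeq_desc (bp_presT S (pi_oP X)) t_prime_eq.

Lemma t_prime1E : t_prime1 ∘ fmap T (pi_o_X X) = pi_o_X (T_i_ob X) ∘ t X.
Proof. exact: coeq_descE. Qed.

Lemma t_prime1_lact :
  t_prime1 ∘ lact (T_i_ob (Tbar_o_ob X)) = lact (Tbar_o_ob (T_i_ob X)) ∘ fmap R t_prime1.
Proof.
apply: (bdesc_act (coeq_epi (bp_presR S (bp_presT S (pi_oP X))))
  (bmor_lact (T_i_map (pi_o_X X))) _ t_prime1E).
rewrite -(comp_assoc (pi_o_X _)) (t_lact) (pre2 (bmor_lact (pi_o_X (T_i_ob X)))).
by rewrite -fmap_comp.
Qed.

Lemma t_prime1_ract :
  t_prime1 ∘ ract (T_i_ob (Tbar_o_ob X)) = ract (Tbar_o_ob (T_i_ob X)) ∘ fmap R t_prime1.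
Proof.
apply: (bdesc_act (coeq_epi (bp_presR S (bp_presT S (pi_oP X))))
  (bmor_ract (T_i_map (pi_o_X X))) _ t_prime1E).
rewrite -(comp_assoc (pi_o_X _)) (t_ract) (pre2 (bmor_ract (pi_o_X (T_i_ob X)))).
by rewrite -fmap_comp.
Qed.

Definition t_prime_X : BimoduleHom (T_i_ob (Tbar_o_ob X)) (Tbar_o_ob (T_i_ob X)) :=
  MkBimoduleHom t_prime1_lact t_prime1_ract.
End TPrime.

Lemma t_prime_nat (X Y : B) (f : Hom X Y) :
  comp (c := B) (t_prime_X Y) (fmap (fcomp T_i Tbar_o) f)
  = comp (c := B) (fmap (fcomp Tbar_o T_i) f) (t_prime_X X).
Proof.
apply: bhom_eq; apply: (coeq_epi (bp_presT S (pi_oP X))).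
rewrite /= -!comp_assoc -fmap_comp Tbar_o_mapE fmap_comp t_prime1E.
by rewrite (pre2 (t_prime1E Y)) tN (pre2 (Tbar_o_mapE (T_i_map f))).
Qed.

Definition t_prime : NatTrans (fcomp T_i Tbar_o) (fcomp Tbar_o T_i) :=
  @MkNatTrans B B (fcomp T_i Tbar_o) (fcomp Tbar_o T_i) t_prime_X t_prime_nat.

Lemma t_primeE X : bmor (t_prime X) ∘ fmap T (pi_o_X X) = pi_o_X (T_i_ob X) ∘ t X.
Proof. exact: t_prime1E. Qed.

Section TBar.
Context (X : Bimodule S).

Definition t_bar1 : BimoduleHom (T_i_ob (Tbar_o_ob X)) (Tbar_o_ob (Tbar_i_ob X)) :=
  bcomp (Tbar_o_map (pi_i_X X)) (t_prime_X X).

Lemma t_bar1E : t_bar1 ∘ fmap T (pi_o_X X) = pi_o_X (Tbar_i_ob X) ∘ fmap T (pi_i_X X) ∘ t X.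
Proof. by rewrite /= -!comp_assoc t_prime1E (pre2 (Tbar_o_mapE (pi_i_X X))). Qed.

Lemma t_xo : t X ∘ xo (T_o_ob X) = fmap T (xo X) ∘ l (T X) ∘ fmap R (t X).
Proof.
rewrite /xo /= fmap_comp -!comp_assoc (pre23 (t_mull X)) -phiN.
by rewrite (pre2 (bpm_A4l phi (T X))).
Qed.

Lemma t_xo0 : t X ∘ xo0 (T_o_ob X) = fmap T (xo0 X) ∘ l (T X) ∘ fmap R (t X).
Proof.
rewrite /xo0 /= /xo0 !fmap_comp -!comp_assoc (pre2 (tN (ract X))).
by rewrite bp_A2.
Qed.

Lemma t_bar1_eq : t_bar1 ∘ xo (Tbar_o_ob X) = t_bar1 ∘ xo0 (Tbar_o_ob X).
Proof.
apply: (coeq_epi (bp_presR S (bp_presT S (pi_oP X)))).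
rewrite -!(comp_assoc t_bar1) -(Tf_xo (pi_o_X X)) -(Tf_xo0 (pi_o_X X)).
rewrite !(pre23 t_bar1E) t_xo t_xo0.
by rewrite (pre2 (map2 T (pi_i_eq X))).
Qed.

Definition t_bar_X : BimoduleHom (Tbar_i_ob (Tbar_o_ob X)) (Tbar_o_ob (Tbar_i_ob X)) := pi_i_desc t_bar1_eq.

Lemma t_bar_XE : t_bar_X ∘ pi_i_X (Tbar_o_ob X) ∘ fmap T (pi_o_X X)
  = pi_o_X (Tbar_i_ob X) ∘ fmap T (pi_i_X X) ∘ t X.
Proof. by rewrite (pre21 (pi_i_descE t_bar1_eq)) t_bar1E. Qed.
End TBar.

Lemma piio_epi X Z (k k' : Hom (Tbar_i_ob (Tbar_o_ob X)) Z) :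
  k ∘ pi_i_X (Tbar_o_ob X) ∘ fmap T (pi_o_X X) = k' ∘ pi_i_X (Tbar_o_ob X) ∘ fmap T (pi_o_X X) ->
  k = k'.
Proof.
move=> E; apply: (coeq_epi (pi_iP _)); apply: (coeq_epi (bp_presT S (pi_oP X))).
by rewrite -!comp_assoc.
Qed.

Lemma t_bar_nat (X Y : B) (f : Hom X Y) :
  comp (c := B) (t_bar_X Y) (fmap (fcomp Tbar_i Tbar_o) f)
  = comp (c := B) (fmap (fcomp Tbar_o Tbar_i) f) (t_bar_X X).
Proof.
apply: bhom_eq; apply: piio_epi; rewrite /= -!comp_assoc t_bar_XE.
rewrite (pre2 (Tbar_i_mapE (Tbar_o_map f))) -fmap_comp Tbar_o_mapE fmap_comp.
rewrite (pre33 (t_bar_XE Y)) tN (pre2 (Tbar_o_mapE (Tbar_i_map f))).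
by rewrite (pre2 (map2 T (Tbar_i_mapE f))).
Qed.

Definition t_bar : NatTrans (fcomp Tbar_i Tbar_o) (fcomp Tbar_o Tbar_i) :=
  @MkNatTrans B B (fcomp Tbar_i Tbar_o) (fcomp Tbar_o Tbar_i) t_bar_X t_bar_nat.

Lemma t_barE X : bmor (t_bar X) ∘ pi_i_X (Tbar_o_ob X) ∘ fmap T (pi_o_X X)
  = pi_o_X (Tbar_i_ob X) ∘ fmap T (pi_i_X X) ∘ t X.
Proof. exact: t_bar_XE. Qed.

Section IBar.
Context (X : Bimodule S).
Local Notation p := (@Pi_p C S).

Lemma p_eq (Y : Bimodule S) : p Y ∘ lact Y = p Y ∘ ract Y.
Proof. exact: (coeq_eq (Pi_p_coequalizer Y)). Qed.

Lemma i_trans1_eq :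
  (p (Tbar_i_ob X) ∘ pi_i_X X) ∘ xi X = (p (Tbar_i_ob X) ∘ pi_i_X X) ∘ xi0 X.
Proof.
rewrite -!(comp_assoc (p _)) (bmor_lact (pi_i_X X)) (bmor_ract (pi_i_X X)).
by rewrite (pre2 (p_eq _)).
Qed.

Definition i_trans1 : Hom (Tbar_o_ob X) (Pi_ob (Tbar_i_ob X)) := coeq_desc (pi_oP X) i_trans1_eq.

Lemma i_trans1E : i_trans1 ∘ pi_o_X X = p (Tbar_i_ob X) ∘ pi_i_X X.
Proof. exact: coeq_descE. Qed.

Lemma i_trans2_eq : i_trans1 ∘ lact (Tbar_o_ob X) = i_trans1 ∘ ract (Tbar_o_ob X).
Proof.
apply: (coeq_epi (bp_presR S (pi_oP X))).
rewrite -!(comp_assoc i_trans1) -(bmor_lact (pi_o_X X)) -(bmor_ract (pi_o_X X)).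
by rewrite !(pre2 i_trans1E) (pi_i_eq X).
Qed.

Definition i_trans_X : Hom (Pi_ob (Tbar_o_ob X)) (Pi_ob (Tbar_i_ob X)) :=
  coeq_desc (Pi_p_coequalizer (Tbar_o_ob X)) i_trans2_eq.

Lemma i_trans_XE : i_trans_X ∘ p (Tbar_o_ob X) ∘ pi_o_X X = p (Tbar_i_ob X) ∘ pi_i_X X.
Proof. by rewrite (pre21 (coeq_descE (Pi_p_coequalizer _) i_trans2_eq)) i_trans1E. Qed.
End IBar.

Lemma i_trans_nat (X Y : B) (f : Hom X Y) :
  i_trans_X Y ∘ fmap (fcomp (Pi S) Tbar_o) f = fmap (fcomp (Pi S) Tbar_i) f ∘ i_trans_X X.
Proof.
apply: (coeq_epi (Pi_p_coequalizer (Tbar_o_ob X))); apply: (coeq_epi (pi_oP X)).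
rewrite /= -!comp_assoc i_trans_XE (pre2 (Pi_mapE (Tbar_o_map f))) Tbar_o_mapE.
by rewrite (pre32 (i_trans_XE Y)) (pre2 (Pi_mapE (Tbar_i_map f))) Tbar_i_mapE.
Qed.

Definition i_trans : NatTrans (fcomp (Pi S) Tbar_o) (fcomp (Pi S) Tbar_i) :=
  @MkNatTrans B C (fcomp (Pi S) Tbar_o) (fcomp (Pi S) Tbar_i) i_trans_X i_trans_nat.
End Constructions.

(* Cofaces and codegeneracies are indexed by all natural numbers [k]; only
   [d n k] with [k <= n + 1] and [s n k] with [k <= n] are meaningful, and
   nothing is required of the other values. *)
Record Cosimplex (C : Category) := MkCosimplex {
  cs_ob :> nat -> C;
  coface : forall n (k : nat), Hom (cs_ob n) (cs_ob (S n));
  codeg : forall n (k : nat), Hom (cs_ob (S n)) (cs_ob n);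
  cs_dd : forall n i j, i <= j -> j <= S n ->
    coface (S n) (S j) ∘ coface n i = coface (S n) i ∘ coface n j;
  cs_ss : forall n i j, i <= j -> j <= n ->
    codeg n j ∘ codeg (S n) i = codeg n i ∘ codeg (S n) (S j);
  cs_sd_lt : forall n i j, i <= j -> j <= n ->
    codeg (S n) (S j) ∘ coface (S n) i = coface n i ∘ codeg n j;
  cs_sd_eq : forall n j, j <= n -> codeg n j ∘ coface n j = idm (cs_ob n);
  cs_sd_eqS : forall n j, j <= n -> codeg n j ∘ coface n (S j) = idm (cs_ob n);
  cs_sd_gt : forall n i j, j < i -> i <= S n ->
    codeg (S n) j ∘ coface (S n) (S i) = coface n i ∘ codeg n j
}.
Arguments coface {C} Z n k : rename.
Arguments codeg {C} Z n k : rename.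

Record is_para_cocyclic (C : Category) (Z : Cosimplex C)
    (w : forall n, Hom (Z n) (Z n)) : Prop := {
  pc_d0 : forall n, w (S n) ∘ coface Z n 0 = coface Z n (S n);
  pc_d : forall n k, k <= n ->
    w (S n) ∘ coface Z n (S k) = coface Z n k ∘ w n;
  pc_s0 : forall n, w n ∘ codeg Z n 0 = codeg Z n n ∘ w (S n) ∘ w (S n);
  pc_s : forall n k, S k <= n ->
    w n ∘ codeg Z n (S k) = codeg Z n k ∘ w (S n)
}.

Fixpoint iter_ob (D : Category) (F : Functor D D) (n : nat) (X : D) : D :=
  match n with
  | 0 => X
  | S m => F (iter_ob F m X)
  end.

Section MonadCosimplex.
Context (D C : Category) (M : Monad D) (P : Functor D C) (X : D).
Local Notation "'M^' n" := (iter_ob M n X) (at level 9, n at level 9).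

(* [M^k (unt (M^(n-k) X))] for [k <= n]; junk for [k > n]. *)
Fixpoint iter_unit (k n : nat) : Hom M^n M^(S n) :=
  match k with
  | 0 => unt M M^n
  | S k' => match n return Hom M^n M^(S n) with
            | 0 => unt M X
            | S n' => fmap M (iter_unit k' n')
            end
  end.

(* [M^k (mul (M^(n-k) X))] for [k <= n]; junk for [k > n]. *)
Fixpoint iter_mul (k n : nat) : Hom M^(S (S n)) M^(S n) :=
  match k with
  | 0 => mul M M^n
  | S k' => match n return Hom M^(S (S n)) M^(S n) with
            | 0 => mul M X
            | S n' => fmap M (iter_mul k' n')
            end
  end.

Lemma iter_unit_unit i j n : i <= j -> j <= n ->
  iter_unit (S j) (S n) ∘ iter_unit i n = iter_unit i (S n) ∘ iter_unit j n.
Proof.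
elim: i j n => [|i IH] [|j] [|n] ij jn; try lia.
- exact: eq_sym (naturality (unt M) _).
- exact: eq_sym (naturality (unt M) _).
- exact: eq_sym (naturality (unt M) _).
- have := IH j n ltac:(lia) ltac:(lia).
  by rewrite /= -!fmap_comp => <-.
Qed.

Lemma iter_mul_mul i j n : i <= j -> j <= n ->
  iter_mul j n ∘ iter_mul i (S n) = iter_mul i n ∘ iter_mul (S j) (S n).
Proof.
elim: i j n => [|i IH] [|j] [|n] ij jn; try lia.
- exact: eq_sym (mul_assoc M _).
- exact: eq_sym (mul_assoc M _).
- exact: eq_sym (naturality (mul M) _).
- have := IH j n ltac:(lia) ltac:(lia).
  by rewrite /= -!fmap_comp => <-.
Qed.

Lemma iter_mul_unit_lt i j n : i <= j -> j <= n ->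
  iter_mul (S j) (S n) ∘ iter_unit i (S (S n)) = iter_unit i (S n) ∘ iter_mul j n.
Proof.
elim: i j n => [|i IH] [|j] [|n] ij jn; try lia.
- exact: eq_sym (naturality (unt M) _).
- exact: eq_sym (naturality (unt M) _).
- exact: eq_sym (naturality (unt M) _).
- have := IH j n ltac:(lia) ltac:(lia).
  by rewrite /= -!fmap_comp => <-.
Qed.

Lemma iter_mul_unit_eq j n : j <= n ->
  iter_mul j n ∘ iter_unit j (S n) = idm M^(S n).
Proof.
elim: j n => [|j IH] [|n] jn; try lia.
- exact: mul_unitl.
- exact: mul_unitl.
- have := IH n ltac:(lia).
  by rewrite /= -!fmap_comp => ->; rewrite fmap_id.
Qed.

Lemma iter_mul_unit_eqS j n : j <= n ->
  iter_mul j n ∘ iter_unit (S j) (S n) = idm M^(S n).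
Proof.
elim: j n => [|j IH] [|n] jn; try lia.
- exact: mul_unitr.
- exact: mul_unitr.
- have := IH n ltac:(lia).
  by rewrite /= -!fmap_comp => ->; rewrite fmap_id.
Qed.

Lemma iter_mul_unit_gt i j n : j < i -> i <= S n ->
  iter_mul j (S n) ∘ iter_unit (S i) (S (S n)) = iter_unit i (S n) ∘ iter_mul j n.
Proof.
elim: j i n => [|j IH] [|i] [|n] ij jn; try lia.
- exact: (naturality (mul M) _).
- exact: (naturality (mul M) _).
- have := IH i n ltac:(lia) ltac:(lia).
  by rewrite /= -!fmap_comp => <-.
Qed.

Definition monad_cosimplex : Cosimplex C.
Proof.
refine (@MkCosimplex C (fun n => P M^(S n))
  (fun n k => fmap P (iter_unit k (S n))) (fun n k => fmap P (iter_mul k n))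
  _ _ _ _ _ _) => *; rewrite -!fmap_comp.
- by rewrite iter_unit_unit.
- by rewrite iter_mul_mul.
- by rewrite iter_mul_unit_lt.
- by rewrite iter_mul_unit_eq // fmap_id.
- by rewrite iter_mul_unit_eqS // fmap_id.
- by rewrite iter_mul_unit_gt.
Defined.
End MonadCosimplex.

Section ParaCocyclicMorphism.
Context (C : Category) (BP : BraidedPair C) (phi : BraidPreservingMor BP).
Context (X : BimodCat BP) (w : Hom (Tbar_i phi X) (Tbar_o phi X)).
Local Notation Tb := (Tbar_o phi).

(* [tw_chain P n] is
   [P Tb^n w ∘ P Tb^(n-1) (t_bar X) ∘ ... ∘ P (t_bar (Tb^(n-1) X))]. *)
Fixpoint tw_chain (P : Functor (BimodCat BP) C) (n : nat) :
    Hom (P (Tbar_i phi (iter_ob Tb n X))) (P (iter_ob Tb (S n) X)) :=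
  match n return
    Hom (P (Tbar_i phi (iter_ob Tb n X))) (P (iter_ob Tb (S n) X)) with
  | 0 => fmap P w
  | S m => tw_chain (fcomp P Tb) m ∘ fmap P (t_bar phi (iter_ob Tb m X))
  end.

Definition wtilde : BimoduleHom (T_i phi X) (Tbar_o phi X) := bcomp w (pi_i phi X).

Definition Z_cosimplex : Cosimplex C := monad_cosimplex (Tbar_o_monad phi) (Pi BP) X.

Definition para_cocyclic_mor (n : nat) : Hom (Z_cosimplex n) (Z_cosimplex n) :=
  tw_chain (Pi BP) n ∘ i_trans phi (iter_ob Tb n X).
End ParaCocyclicMorphism.

(* Main.v *)
From Stdlib Require Import ssreflect Lia.
Require Import Defs.

Set Implicit Arguments.
Unset Strict Implicit.
Unset Printing Implicit Defensive.

(** A transposition map from a second functor [I] to a monad [M] on a category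
    [D] is a morphism [w : I X -> M X] which carries the unit of [I] to that of
    [M] and which is multiplicative up to a distributive law [br : I M -> M I].
    A functor [P] out of [D] with a comparison [i : P M -> P I] then makes the
    cosimplex [P M^(n+1) X] rotate: [i] turns the outermost copy of [M] into a
    copy of [I], the law carries this copy past the remaining [n] copies of [M],
    and [w] turns it back into the innermost copy of [M]. A coface or a
    codegeneracy away from the outermost copy is met by the travelling copy and
    crossed, its index dropping by one, because [br] is compatible with the unit
    and the multiplication of [M]. The zeroth coface creates the travelling copy
    as a unit, which arrives as a unit; the zeroth codegeneracy makes it a
    product, and a product travels as its two factors, one rotation for each,
    which are multiplied on arrival. This is [transposition_para_cocyclic].

    For a braided pair, [M] and [I] are the two quotients of [T] on bimodules,
    and [br] is [t_bar], induced by the braiding [t] of [T] with itself. The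
    multiplication on the second quotient is induced by [mul_tinv], the product
    of [T] precomposed with the inverse of [t]. The distributive law axioms of
    [t_bar] descend from those of [t], the one for [mul_tinv] with the help of
    the Yang-Baxter equation ([t_bar_mul_i]); the comparison [i_trans] is
    compatible with the multiplications because the braiding that it produces
    cancels the inverse in [mul_tinv] ([i_trans_mul]). The same cancellation
    turns the hypotheses on the composite of [w] with the projection into the
    two axioms of a transposition map. All these identities are checked after
    composing with the projections, which are epimorphisms, where they become
    identities between [t], the product and the unit of [T]. *)

(** * Transposition maps for a monad and a braided second monad *)

Section Transposition.
Context (D C : Category) (M : Monad D) (I : Functor D D).
Context (unit_I : forall Y : D, Hom Y (I Y)) (mul_I : forall Y : D, Hom (I (I Y)) (I Y)).
Context (br : NatTrans (fcomp I M) (fcomp M I)).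
Context (br_unit_I : forall Y, br Y ∘ unit_I (M Y) = fmap M (unit_I Y)).
Context (br_unit_M : forall Y, br Y ∘ fmap I (unt M Y) = unt M (I Y)).
Context (br_mul_I : forall Y,
  br Y ∘ mul_I (M Y) = fmap M (mul_I Y) ∘ br (I Y) ∘ fmap I (br Y)).
Context (br_mul_M : forall Y,
  br Y ∘ fmap I (mul M Y) = mul M (I Y) ∘ fmap M (br Y) ∘ br (M Y)).
Context (X : D) (w : Hom (I X) (M X)).
Context (w_unit : w ∘ unit_I X = unt M X).
Context (w_mul : w ∘ mul_I X = mul M X ∘ fmap M w ∘ br X ∘ fmap I w).
Local Notation "M^ n" := (iter_ob M n X) (at level 9, n at level 9, format "M^ n").
Local Notation iunit := (iter_unit M X).
Local Notation imul := (iter_mul M X).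

Fixpoint chain (P : Functor D C) (n : nat) : Hom (P (I M^n)) (P M^(S n)) :=
  match n return Hom (P (I M^n)) (P M^(S n)) with
  | 0 => fmap P w
  | S m => chain (fcomp P M) m ∘ fmap P (br M^m)
  end.

(** The recursion of [chain] enlarges [P] to [P M], so that the inductions
    below generalize [P]; naturality in [P] is what moves a transformation
    created at the head of a chain past its tail. *)
Lemma chain_nat (P Q : Functor D C) (alpha : forall Y : D, Hom (P Y) (Q Y)) n :
  (forall (Y Z : D) (f : Hom Y Z), alpha Z ∘ fmap P f = fmap Q f ∘ alpha Y) ->
  chain Q n ∘ alpha (I M^n) = alpha M^(S n) ∘ chain P n.
Proof.
elim: n P Q alpha => [|n IH] P Q alpha N /=; first by rewrite -N.
rewrite -comp_assoc -N.
rewrite (pre2 (IH (fcomp P M) (fcomp Q M) (fun Y => alpha (M Y)) _)) //.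
by move=> Y Z f; apply: N.
Qed.

Lemma chain_iter_unit (P : Functor D C) k n : k <= n ->
  chain P (S n) ∘ fmap P (fmap I (iunit k n)) = fmap P (iunit k (S n)) ∘ chain P n.
Proof.
elim: k n P => [|k IH] n P kn.
- rewrite /= -comp_assoc -fmap_comp br_unit_M.
  apply: (chain_nat (Q := fcomp P M) (alpha := fun Y => fmap P (unt M Y))) => Y Z f /=.
  by rewrite -!fmap_comp -(naturality (unt M)).
- case: n kn => [|n] kn; first by lia.
  have E := IH n (fcomp P M) ltac:(lia).
  have N := naturality br (iunit k n).
  by apply: (eq_trans _ (pre2 E _)); rewrite -comp_assoc -!fmap_comp N.
Qed.

Lemma chain_iter_mul (P : Functor D C) k n : k <= n ->
  chain P (S n) ∘ fmap P (fmap I (imul k n)) = fmap P (imul k (S n)) ∘ chain P (S (S n)).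
Proof.
elim: k n P => [|k IH] n P kn.
- rewrite /= -!comp_assoc -fmap_comp br_mul_M !fmap_comp.
  apply: (pre2 (chain_nat (P := fcomp (fcomp P M) M) (Q := fcomp P M)
    (alpha := fun Y => fmap P (mul M Y)) n _)) => Y Z f /=.
  by rewrite -!fmap_comp -(naturality (mul M)).
- case: n kn => [|n] kn; first by lia.
  have E := IH n (fcomp P M) ltac:(lia).
  have N := naturality br (imul k n).
  by apply: (eq_trans _ (pre2 E _)); rewrite -comp_assoc -!fmap_comp N.
Qed.

Lemma chain_unit (P : Functor D C) n :
  chain P n ∘ fmap P (unit_I M^n) = fmap P (iunit n n).
Proof.
elim: n P => [|n IH] P; first by rewrite /= -fmap_comp w_unit.
by rewrite /= -comp_assoc -fmap_comp br_unit_I; apply: (IH (fcomp P M)).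
Qed.

(** Two copies of [w] are transported, the inner one first, through [P I] and
    then through [P]; each ends up in the last place, where they are multiplied. *)
Lemma chain_mul (P : Functor D C) n :
  chain P n ∘ fmap P (mul_I M^n) = fmap P (imul n n) ∘ chain P (S n) ∘ chain (fcomp P I) n.
Proof.
elim: n P => [|n IH] P; first by rewrite /= -!comp_assoc -!fmap_comp w_mul.
rewrite [chain P (S n)]/= -comp_assoc -fmap_comp br_mul_I !fmap_comp.
apply: eq_trans (pre23 (IH (fcomp P M)) _) _.
have E := chain_nat (P := fcomp (fcomp P I) M) (Q := fcomp (fcomp P M) I)
    (alpha := fun Y => fmap P (br Y)) n _.
rewrite (pre2 (E _)) -?comp_assoc // => Y Z f /=.
by rewrite -!fmap_comp -(naturality br).
Qed.

Context (P : Functor D C) (i : NatTrans (fcomp P M) (fcomp P I)).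
Context (i_unit : forall Y, i Y ∘ fmap P (unt M Y) = fmap P (unit_I Y)).
Context (i_mul : forall Y,
  i Y ∘ fmap P (mul M Y) = fmap P (mul_I Y) ∘ i (I Y) ∘ fmap P (br Y) ∘ i (M Y)).

(** The square of the cyclic operator in the relation for the zeroth
    codegeneracy appears when [i] is moved past the inner chain of [chain_mul]:
    each half of the composite is then a full rotation. *)
Lemma transposition_para_cocyclic :
  @is_para_cocyclic C (monad_cosimplex M P X) (fun n => chain P n ∘ i M^n).
Proof.
have iN Y Z (f : Hom Y Z) : i Z ∘ fmap P (fmap M f) = fmap P (fmap I f) ∘ i Y.
  exact: (naturality i f).
split=> [n|n k kn|n|n k kn].
- by rewrite [coface _ _ _]/= -comp_assoc i_unit (chain_unit P (S n)).
- by rewrite /= -comp_assoc iN; apply: (pre2 (chain_iter_unit P kn)).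
- rewrite [codeg _ _ _]/= -comp_assoc i_mul (pre23 (chain_mul P n)).
  have E := chain_nat (alpha := i) n iN.
  by rewrite -!comp_assoc (pre2 E).
- case: n kn => [|n] kn; first by lia.
  by rewrite /= -comp_assoc iN; apply: (pre2 (chain_iter_mul P _)); lia.
Qed.
End Transposition.

(** * The second monad structure on bimodules *)

Section SecondMonad.
Context (C : Category) (S : BraidedPair C) (phi : BraidPreservingMor S).
Local Notation R := (bp_R S).
Local Notation T := (bp_T S).
Local Notation l := (bp_l S).
Local Notation t := (bp_t S).
Local Notation ti := (iso_inv (bp_t S)).
Local Notation mu := (mul (bp_T S)).
Local Notation tau := (unt (bp_T S)).
Local Notation xi0 := (xi0 phi).
Local Notation xo := (xo phi).
Local Notation Ti := (T_i_ob phi).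
Local Notation To := (T_o_ob phi).
Local Notation Tbi := (Tbar_i_ob phi).
Local Notation Tbo := (Tbar_o_ob phi).
Local Notation pi_i := (pi_i_X phi).
Local Notation pi_o := (pi_o_X phi).

Lemma t_invK X : ti X ∘ t X = idm (T (T X)).
Proof. exact: (iso_invK t X). Qed.

Lemma t_homK X : t X ∘ ti X = idm (T (T X)).
Proof. exact: (iso_homK t X). Qed.

Lemma t_inv_nat X Y (f : Hom X Y) :
  ti Y ∘ fmap T (fmap T f) = fmap T (fmap T f) ∘ ti X.
Proof. exact: (naturality ti f). Qed.

(** The braiding [t] carries the action [xo (T_o X)], along which the product is
    equivariant, to [T (xo X) ∘ l], along which a map out of [T (T X)] has to
    descend to reach the quotient by [xo] and [xo0]. So it is the product
    composed with the inverse of [t] that descends. *)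
Definition mul_tinv (X : C) : Hom (T (T X)) (T X) := mu X ∘ ti X.

Lemma mul_tinv_nat X Y (f : Hom X Y) :
  mul_tinv Y ∘ fmap T (fmap T f) = fmap T f ∘ mul_tinv X.
Proof. by rewrite /mul_tinv -comp_assoc t_inv_nat (pre2 (muTN S f)). Qed.

(** A square [t ∘ a = b ∘ R t] may be turned around by composing with the
    inverse of [t] on both sides, which is how the compatibilities of [t] with
    the actions on [T_i X] and [T_o X] become compatibilities of [mul_tinv]. *)
Lemma mul_tinv_flip X (a b : Hom (R (T (T X))) (T (T X))) :
  t X ∘ a = b ∘ fmap R (t X) -> mul_tinv X ∘ b = mu X ∘ a ∘ fmap R (ti X).
Proof.
move=> E.
have -> : b = t X ∘ a ∘ fmap R (ti X).
  by rewrite comp_assoc E -comp_assoc -fmap_comp t_homK fmap_id comp_idr.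
by rewrite /mul_tinv -!comp_assoc (pre21 (t_invK X)) comp_idl.
Qed.

Lemma mul_tinv_act X (a b : Hom (R (T (T X))) (T (T X))) (c : Hom (R (T X)) (T X)) :
  t X ∘ a = b ∘ fmap R (t X) -> mu X ∘ a = c ∘ fmap R (mu X) ->
  mul_tinv X ∘ b = c ∘ fmap R (mul_tinv X).
Proof.
by move=> /mul_tinv_flip -> E; rewrite (pre2 E) -fmap_comp.
Qed.

Lemma mul_tinv_xi (X : Bimodule S) :
  mul_tinv X ∘ xi (Ti X) = xi X ∘ fmap R (mul_tinv X).
Proof. exact: mul_tinv_act (t_xi phi X) (muT_xi X). Qed.

Lemma mul_tinv_xi0 (X : Bimodule S) :
  mul_tinv X ∘ xi0 (Ti X) = xi0 X ∘ fmap R (mul_tinv X).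
Proof. exact: mul_tinv_act (t_xi0 phi X) (muT_xi0 phi X). Qed.

Lemma mul_tinv_Txo (X : Bimodule S) :
  mul_tinv X ∘ fmap T (xo X) ∘ l (T X) = xo X ∘ fmap R (mul_tinv X).
Proof.
apply: (mul_tinv_act (a := xo (To X))); first by rewrite t_xo comp_assoc.
by rewrite /Defs.xo /= -!comp_assoc (phiN phi (mu X)) (pre2 (mul_assoc T X)).
Qed.

Lemma mul_tinv_Txo0 (X : Bimodule S) :
  mul_tinv X ∘ fmap T (xo0 X) ∘ l (T X) = xo0 X ∘ fmap R (mul_tinv X).
Proof.
apply: (mul_tinv_act (a := xo0 (To X))); first by rewrite (t_xo0 phi) comp_assoc.
rewrite /xo0 /= /xo0 fmap_comp -!comp_assoc.
by rewrite (pre2 (muTN S (ract X))) (l_mulT S X).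
Qed.

(** The two actions of [T_o (T_i X)] come from the left and the right action on
    [T_i (T_o X)], whose composites with the product both multiply [phi] into
    the middle of [T (T X)]. *)
Lemma mul_tinv_xo (X : Bimodule S) : mul_tinv X ∘ xo (Ti X) = mul_tinv X ∘ xo0 (Ti X).
Proof.
rewrite (mul_tinv_flip (t_lact phi X)) (mul_tinv_flip (t_ract phi X)).
rewrite /xi /Defs.xi0 /= /Defs.xo !fmap_comp -!comp_assoc.
by rewrite (pre2 (mul_assoc T X)).
Qed.

Section Mul.
Context (X : Bimodule S).
Let PT := bp_presT S (pi_iP phi X).

Lemma pi_i_mul_eq :
  (pi_i X ∘ mul_tinv X) ∘ fmap T (xo X) = (pi_i X ∘ mul_tinv X) ∘ fmap T (xo0 X).
Proof.
apply: l_epi; rewrite -!(comp_assoc (pi_i X)) -!(comp_assoc (mul_tinv X)).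
by rewrite mul_tinv_Txo mul_tinv_Txo0 (pre2 (pi_i_eq phi X)).
Qed.

Definition t_bar_i1 : Hom (T (Tbi X)) (Tbi X) := coeq_desc PT pi_i_mul_eq.

Lemma t_bar_i1E : t_bar_i1 ∘ fmap T (pi_i X) = pi_i X ∘ mul_tinv X.
Proof. exact: coeq_descE. Qed.

Lemma t_bar_i1_lact : t_bar_i1 ∘ lact (Ti (Tbi X)) = lact (Tbi X) ∘ fmap R t_bar_i1.
Proof.
apply: (bdesc_act (coeq_epi (bp_presR S PT)) (Tf_xi (pi_i X)) _ t_bar_i1E).
rewrite -comp_assoc (mul_tinv_xi X) (pre2 (bmor_lact (pi_i X))).
by rewrite -fmap_comp.
Qed.

Lemma t_bar_i1_ract : t_bar_i1 ∘ ract (Ti (Tbi X)) = ract (Tbi X) ∘ fmap R t_bar_i1.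
Proof.
apply: (bdesc_act (coeq_epi (bp_presR S PT)) (Tf_xi0 phi (pi_i X)) _ t_bar_i1E).
rewrite -comp_assoc (mul_tinv_xi0 X) (pre2 (bmor_ract (pi_i X))).
by rewrite -fmap_comp.
Qed.

Definition t_bar_i1_hom : BimoduleHom (Ti (Tbi X)) (Tbi X) :=
  MkBimoduleHom t_bar_i1_lact t_bar_i1_ract.

Lemma t_bar_i1_eq : t_bar_i1_hom ∘ xo (Tbi X) = t_bar_i1_hom ∘ xo0 (Tbi X).
Proof.
apply: (coeq_epi (bp_presR S PT)).
rewrite /= -!(comp_assoc t_bar_i1) -(Tf_xo phi (pi_i X)) -(Tf_xo0 (pi_i X)).
by rewrite !(pre2 t_bar_i1E) mul_tinv_xo.
Qed.

Definition t_bar_i : BimoduleHom (Tbi (Tbi X)) (Tbi X) := pi_i_desc t_bar_i1_eq.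

Lemma t_bar_iE : t_bar_i ∘ pi_i (Tbi X) ∘ fmap T (pi_i X) = pi_i X ∘ mul_tinv X.
Proof. by rewrite (pre21 (pi_i_descE t_bar_i1_eq)) t_bar_i1E. Qed.

Lemma tau_bar_i_lact :
  (pi_i X ∘ tau X) ∘ lact X = lact (Tbi X) ∘ fmap R (pi_i X ∘ tau X).
Proof.
rewrite fmap_comp comp_assoc -(bmor_lact (pi_i X)) -!comp_assoc (tauN S).
by rewrite l_tau.
Qed.

(** The right action on [T_i X] is made of the multiplication of [T], whereas
    [tau] only sees the right action of [X]; the two agree on the unit because
    [pi_i] coequalizes the actions of [T_o X]. *)
Lemma tau_bar_i_ract :
  (pi_i X ∘ tau X) ∘ ract X = ract (Tbi X) ∘ fmap R (pi_i X ∘ tau X).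
Proof.
rewrite fmap_comp comp_assoc -(bmor_ract (pi_i X)) -!comp_assoc (tauN S).
have E : xi0 X ∘ fmap R (tau X) = xo X ∘ fmap R (tau X).
  rewrite /Defs.xi0 /Defs.xo -!comp_assoc (l_tau S) -(tauN S) (phiN phi).
  by rewrite (pre21 (mul_unitl T X)) (pre21 (mul_unitr T X)).
have -> : fmap T (ract X) ∘ tau (R X) = xo0 X ∘ fmap R (tau X).
  by rewrite /xo0 -comp_assoc l_tau.
by rewrite -(pre2 (pi_i_eq phi X)) -E /Defs.xi0 -!comp_assoc.
Qed.

Definition tau_bar_i : BimoduleHom X (Tbi X) := MkBimoduleHom tau_bar_i_lact tau_bar_i_ract.
End Mul.

Lemma pi_i2_epi (X : Bimodule S) Z (k k' : Hom (Tbi (Tbi X)) Z) :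
  k ∘ pi_i (Tbi X) ∘ fmap T (pi_i X) = k' ∘ pi_i (Tbi X) ∘ fmap T (pi_i X) -> k = k'.
Proof.
move=> E; apply: (coeq_epi (pi_iP phi _)); apply: (coeq_epi (bp_presT S (pi_iP phi X))).
by rewrite -!comp_assoc.
Qed.

(** * The braiding as a distributive law *)

(** Rewriting with this equation, unlike simplification, keeps the quotient
    bimodules folded in the goals below. *)
Lemma bcompE (X Y Z : Bimodule S) (g : BimoduleHom Y Z) (f : BimoduleHom X Y) :
  bmor (bcomp g f) = g ∘ f.
Proof. by []. Qed.

Lemma t_bar_tau_i (X : Bimodule S) :
  bcomp (t_bar_X phi X) (tau_bar_i (Tbo X)) = Tbar_o_map phi (tau_bar_i X).
Proof.
apply: bhom_eq; apply: (coeq_epi (pi_oP phi X)).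
rewrite Tbar_o_mapE /= -!comp_assoc (tauN S) (pre33 (t_bar_XE phi X)).
case: (bp_tbd S) => -[_ _ ul _] _.
by rewrite ul fmap_comp.
Qed.

Lemma t_bar_tau_o (X : Bimodule S) :
  bcomp (t_bar_X phi X) (Tbar_i_map phi (tau_bar_o_X phi X)) = tau_bar_o_X phi (Tbi X).
Proof.
apply: bhom_eq; apply: (coeq_epi (pi_iP phi X)).
rewrite !bcompE -!comp_assoc (Tbar_i_mapE phi (tau_bar_o_X phi X)) /= fmap_comp.
rewrite (pre33 (t_bar_XE phi X)).
case: (bp_tbd S) => -[_ _ _ ur] _.
by rewrite ur -(tauN S).
Qed.

(** The distributive law axiom for [mul] leaves the inverse of [t] to be moved
    past two copies of [t], which the Yang-Baxter equation permits. *)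
Lemma t_mul_tinv X :
  t X ∘ mul_tinv (T X) = fmap T (mul_tinv X) ∘ t (T X) ∘ fmap T (t X).
Proof.
have YB : t (T X) ∘ fmap T (t X) ∘ ti (T X) = fmap T (ti X) ∘ t (T X) ∘ fmap T (t X).
  case: (bp_tbd S) => _ yb.
  rewrite -(comp_idl (t (T X) ∘ _)) -(fmap_id T) -(t_invK X) fmap_comp -!comp_assoc.
  by rewrite -(pre33 (yb X)) t_homK comp_idr.
by rewrite /mul_tinv (pre23 (t_mull S X)) YB fmap_comp -!comp_assoc.
Qed.

Lemma t_bar_mul_i (X : Bimodule S) :
  bcomp (t_bar_X phi X) (t_bar_i (Tbo X)) =
  bcomp (Tbar_o_map phi (t_bar_i X))
    (bcomp (t_bar_X phi (Tbi X)) (Tbar_i_map phi (t_bar_X phi X))).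
Proof.
have E := f_equal (fmap T) (t_bar_iE X); rewrite !fmap_comp in E.
apply: bhom_eq; apply: pi_i2_epi.
apply: (coeq_epi (bp_presT S (bp_presT S (pi_oP phi X)))).
rewrite !bcompE -!comp_assoc.
rewrite (pre32 (t_bar_iE (Tbo X))).
rewrite (mul_tinv_nat (pi_o X)).
rewrite (pre33 (t_bar_XE phi X)).
rewrite (pre2 (Tbar_i_mapE phi (t_bar_X phi X))).
rewrite (map33 T (t_bar_XE phi X)) (pre33 (t_bar_XE phi (Tbi X))) (pre2 (tN S (pi_i X))).
rewrite (pre2 (Tbar_o_mapE phi (t_bar_i X))) (pre32 E).
by rewrite t_mul_tinv /mul_tinv fmap_comp -!comp_assoc.
Qed.

Lemma t_bar_mul_o (X : Bimodule S) :
  bcomp (t_bar_X phi X) (Tbar_i_map phi (t_bar_o_X phi X)) =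
  bcomp (t_bar_o_X phi (Tbi X))
    (bcomp (Tbar_o_map phi (t_bar_X phi X)) (t_bar_X phi (Tbo X))).
Proof.
have E := f_equal (fmap T) (t_bar_o_XE phi X); rewrite !fmap_comp in E.
apply: bhom_eq; apply: piio_epi.
apply: (coeq_epi (bp_presT S (bp_presT S (pi_oP phi X)))).
rewrite !bcompE -!comp_assoc (pre2 (Tbar_i_mapE phi (t_bar_o_X phi X))) E.
rewrite (pre33 (t_bar_XE phi X)) (pre33 (t_bar_XE phi (Tbo X))) (tN S (pi_o X)).
rewrite (pre2 (Tbar_o_mapE phi (t_bar_X phi X))) (pre33 (map33 T (t_bar_XE phi X))).
rewrite (pre32 (t_bar_o_XE phi (Tbi X))) (pre2 (muTN S (pi_i X))).
by rewrite (t_mulr S X).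
Qed.

(** * The comparison after passing to the base category *)

Lemma i_trans_tau (X : Bimodule S) :
  i_trans_X phi X ∘ Pi_map (tau_bar_o_X phi X) = Pi_map (tau_bar_i X).
Proof.
apply: (coeq_epi (Pi_p_coequalizer X)).
by rewrite -comp_assoc !Pi_mapE /= (pre32 (i_trans_XE phi X)).
Qed.

(** Going around once with [i_trans] in each of the two factors braids them once;
    this single [t] cancels the inverse in [mul_tinv]. *)
Lemma i_trans_mul (X : Bimodule S) :
  i_trans_X phi X ∘ Pi_map (t_bar_o_X phi X) =
  Pi_map (t_bar_i X) ∘ i_trans_X phi (Tbi X) ∘ Pi_map (t_bar_X phi X) ∘ i_trans_X phi (Tbo X).
Proof.
apply: (coeq_epi (Pi_p_coequalizer _)); apply: pi_o2_epi.
rewrite -!comp_assoc (pre2 (Pi_mapE (t_bar_o_X phi X))) (t_bar_o_XE phi X).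
rewrite (pre32 (i_trans_XE phi X)) (pre32 (i_trans_XE phi (Tbo X))).
rewrite (pre2 (Pi_mapE (t_bar_X phi X))) (t_bar_XE phi X) (pre32 (i_trans_XE phi (Tbi X))).
rewrite (pre2 (Pi_mapE (t_bar_i X))) (pre32 (t_bar_iE X)).
by rewrite /mul_tinv -!comp_assoc t_invK comp_idr.
Qed.

(** * The transposition map carried by a bimodule morphism *)

Lemma transposition_unit (X : Bimodule S) (w : BimoduleHom (Tbi X) (Tbo X)) :
  wtilde (X := X) w ∘ tau X = tau_bar_o_X phi X ->
  bcomp w (tau_bar_i X) = tau_bar_o_X phi X.
Proof. by move=> E; apply: bhom_eq; rewrite bcompE -E /= comp_assoc. Qed.

Lemma transposition_mul (X : Bimodule S) (w : BimoduleHom (Tbi X) (Tbo X)) :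
  let wt : BimoduleHom (Ti X) (Tbo X) := wtilde (X := X) w in
  wt ∘ mu X = t_bar_o_X phi X ∘ Tbar_o_map phi wt ∘ t_prime_X phi X ∘ fmap T wt ∘ t X ->
  bcomp w (t_bar_i X) =
  bcomp (t_bar_o_X phi X)
    (bcomp (Tbar_o_map phi w) (bcomp (t_bar_X phi X) (Tbar_i_map phi w))).
Proof.
move=> wt E; apply: bhom_eq; apply: pi_i2_epi.
have Ew : bmor wt = w ∘ pi_i X by [].
have Et : t_bar_X phi X ∘ pi_i (Tbo X) = Tbar_o_map phi (pi_i X) ∘ t_prime_X phi X.
  exact: pi_i_descE.
have Emap : Tbar_o_map phi w ∘ Tbar_o_map phi (pi_i X) = Tbar_o_map phi wt.
  by rewrite -bcompE -Tbar_o_map_comp.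
rewrite !bcompE -!comp_assoc t_bar_iE /mul_tinv (pre21 (eq_sym Ew)) (pre21 E).
rewrite -!comp_assoc t_homK comp_idr (pre2 (Tbar_i_mapE phi w)).
by rewrite (map21 T (eq_sym Ew)) (pre2 Et) (pre21 Emap).
Qed.
End SecondMonad.

Theorem corollary3p13
  (C : Category) (S : BraidedPair C) (phi : BraidPreservingMor S)
  (X : BimodCat S) (w : Hom (Tbar_i phi X) (Tbar_o phi X)) :
  let wt := wtilde w in
  wt ∘ unt (bp_T S) (bcar X) = bmor (tau_bar_o phi X) ->
  wt ∘ mul (bp_T S) (bcar X)
    = bmor (t_bar_o phi X) ∘ bmor (fmap (Tbar_o phi) wt) ∘ bmor (t_prime phi X)
      ∘ fmap (bp_T S) wt ∘ bp_t S (bcar X) ->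
  is_para_cocyclic (para_cocyclic_mor w).
Proof.
move=> wt w_unit w_mul.
apply: (@transposition_para_cocyclic (BimodCat S) C (Tbar_o_monad phi) (Tbar_i phi)
  (tau_bar_i phi) (t_bar_i phi) (t_bar phi)).
- exact: t_bar_tau_i.
- exact: t_bar_tau_o.
- exact: t_bar_mul_i.
- exact: t_bar_mul_o.
- exact: transposition_unit.
- exact: transposition_mul.
- exact: i_trans_tau.
- exact: i_trans_mul.
Qed.
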